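(* Let $\mathcal{H}$ be a $d$-dimensional real Hilbert space, let $c_1,\dots,c_m:\mathcal{H}\to\mathbb{R}$ be smooth functions such that $\nabla c_1(x),\dots,\nabla c_m(x)$ are linearly independent at every $x$ in $\mathcal{M}=\{x\in\mathcal{H}: c_1(x)=\cdots=c_m(x)=0\}$, and let $1\leqslant k\leqslant d-m$. Assume that $E:\mathcal{H}\to\mathbb{R}$ is a $\mathcal{C}^3$ functional, $x^\ast\in\mathcal{M}$, $\{v_i^\ast\}_{i=1}^k\subset T(x^\ast)$ satisfies $\|v_i^\ast\|=1$ for $i=1,\dots,k$, $\mu>0$, and $\operatorname{Hess}E(x^\ast)$ is nondegenerate (invertible on $T(x^\ast)$) with eigenvalues $\lambda_1^\ast<\cdots<\lambda_k^\ast\leqslant\lambda_{k+1}^\ast\leqslant\cdots\leqslant\lambda_{d-m}^\ast$. Consider the dynamical system for $(x,v_1,\dots,v_k)$ $$ \begin{aligned} \dot{x}&=-\Big(\mathbf{I}-\sum_{i=1}^{k}2v_iv_i^\top\Big)\operatorname{grad}E(x)-\mu\sum_{l=1}^m c_l(x)\nabla c_l(x),\\ \dot{v}_i&=-\Big(\mathbf{I}-v_iv_i^\top-\sum_{j=1}^{i-1}2v_jv_j^\top\Big)\operatorname{\widetilde{Hess}}E(x)[v_i]-\mathbf{A}(x)\left(\mathbf{A}(x)^\top\mathbf{A}(x)\right)^{-1}\left(\nabla^2 c(x)\dot{x}\right)^\top v_i,\quad i=1,\dots,k, \end{aligned} $$ where in the equations for $\dot v_i$ the symbol $\dot x$ stands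 for the right-hand side of the first equation. Then $(x^\ast,v_1^\ast,\dots,v_k^\ast)$ is a linearly stable steady state of this system if and only if $x^\ast$ is a $k$-saddle (of $E$ on $\mathcal{M}$) and $\operatorname{Hess}E(x^\ast)[v_i^\ast]=\lambda_i^\ast v_i^\ast$ for $i=1,\dots,k$.
   Context: $\mathcal{H}$ has inner product $\langle\cdot,\cdot\rangle$ and norm $\|\cdot\|$. For a functional $f$ on $\mathcal{H}$, $\nabla f(x)\in\mathcal{H}$ is the gradient (Riesz representative of the Fr\'echet derivative) and $\nabla^2 f(x)$ is the Hessian, a linear operator on $\mathcal{H}$. $\mathbf{I}$ is the identity on $\mathcal{H}$. Notation: for tuples $\mathbf{A}=(a_1,\dots,a_p)$, $\mathbf{B}=(b_1,\dots,b_q)$ of vectors of $\mathcal{H}$ (viewed as matrices with columns in $\mathcal{H}$, so $\mathbf{A}$ acts on $\mathbb{R}^p$ by $\mathbf{A}t=\sum_i t_ia_i$), $\mathbf{A}^\top\mathbf{B}$ is the $p\times q$ real matrix with $(i,j)$-entry $\langle b_j,a_i\rangle$; in particular $\mathbf{A}^\top v=(\langle v,a_i\rangle)_{i=1}^p$ for $v\in\mathcal{H}$, and $vv^\top$ is the operator $w\mapsto\langle v,w\rangle v$. Put $c=(c_1,\dots,c_m)$, $\mathbf{A}(x)=(\nabla c_1(x),\dots,\nabla c_m(x))$, and $\nabla^2c(x)\eta=(\nabla^2c_1(x)\eta,\dots,\nabla^2c_m(x)\eta)$ for $\eta\in\mathcal{H}$. By the linear independence assumption, $\mathbf{A}(x)^\top\mathbf{A}(x)$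 is positive definite for $x\in\mathcal{M}$ and in a neighbourhood in $\mathcal{H}$ of each point of $\mathcal{M}$. For such $x$ define: - the tangent space $T(x)=\{v\in\mathcal{H}:\mathbf{A}(x)^\top v=0\}$ and the orthogonal projection $\mathbf{P}_{T(x)}=\mathbf{I}-\mathbf{A}(x)(\mathbf{A}(x)^\top\mathbf{A}(x))^{-1}\mathbf{A}(x)^\top$ onto it; - the Riemannian gradient $\operatorname{grad}E(x)=\mathbf{P}_{T(x)}\nabla E(x)$; - the Riemannian Hessian $\operatorname{Hess}E(x):T(x)\to T(x)$, $$\operatorname{Hess}E(x)[\eta]=\mathbf{P}_{T(x)}\Big(\nabla^2E(x)\eta-\nabla^2c(x)\eta\,\big(\mathbf{A}(x)^\top\mathbf{A}(x)\big)^{-1}\mathbf{A}(x)^\top\nabla E(x)\Big),$$ where the tuple $\nabla^2c(x)\eta$ acts on the vector $(\mathbf{A}^\top\mathbf{A})^{-1}\mathbf{A}^\top\nabla E\in\mathbb{R}^m$ as a linear combination of its entries; this is a symmetric operator on $T(x)$; - its extension to $\mathcal{H}$, $\operatorname{\widetilde{Hess}}E(x)[\eta]=\operatorname{Hess}E(x)[\mathbf{P}_{T(x)}\eta]$ for $\eta\in\mathcal{H}$. These formulas are used for all $x$ in a neighbourhood in $\mathcal{H}$ of the given point of $\mathcal{M}$, so the dynamical system is an ODE for $(x,v_1,\dots,v_k)$ in an open subset of $\mathcal{H}^{k+1}$ (the variables are not restricted to $\mathcal{M}$ or to tangent vectors). A point $\hat x\in\mathcal{M}$ is a stationary point of $E$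 on $\mathcal{M}$ if $\operatorname{grad}E(\hat x)=0$. Its (Morse) index is the maximal dimension of a subspace of $T(\hat x)$ on which $\operatorname{Hess}E(\hat x)$ is negative definite. A $k$-saddle (index-$k$ saddle point) is a stationary point of index $k$. A steady state is a point at which all right-hand sides vanish. It is linearly stable if all eigenvalues of the Jacobian operator (on $\mathcal{H}^{k+1}$) of the right-hand side with respect to $(x,v_1,\dots,v_k)$ at that point have negative real part. *)

(* Defs.v *)
From HB Require Import structures.
From mathcomp Require Import all_boot all_order all_algebra.
From mathcomp Require Import complex.
From mathcomp Require Import all_classical all_reals all_analysis.

Set Implicit Arguments.
Unset Strict Implicit.
Unset Printing Implicit Defensive.

Import Order.TTheory GRing.Theory Num.Theory.
Import numFieldNormedType.Exports.

Local Open Scope classical_set_scope.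
Local Open Scope ring_scope.

#[short(type="finNormedModType")]
HB.structure Definition FinNormedModule (R : numFieldType) :=
  {V of NormedModule R V & Vector R V}.

(* The l^1 norm makes V ^ n a normed module; as V ^ n is only used with V of
   finite dimension, differentials do not depend on the choice of this norm. *)
Section FfunNorm.
Context (R : numFieldType) (V : normedModType R) (n : nat).
Implicit Types (f g : {ffun 'I_n -> V}) (a : R).

Definition ffun_norm f : R := \sum_i `|f i|.

Lemma ffun_normD f g : ffun_norm (f + g) <= ffun_norm f + ffun_norm g.
Proof.
rewrite /ffun_norm -big_split /=; apply: ler_sum => i _.
by rewrite ffunE ler_normD.
Qed.

Lemma ffun_normZ a f : ffun_norm (a *: f) = `|a| * ffun_norm f.
Proof.
by rewrite /ffun_norm mulr_sumr; apply: eq_bigr => i _; rewrite ffunE normrZ.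
Qed.

Lemma ffun_norm_eq0 f : ffun_norm f = 0 -> f = 0.
Proof.
move=> /eqP; rewrite psumr_eq0 => [/allP f0|i _]; last exact: normr_ge0.
apply/ffunP => i; rewrite ffunE; apply/eqP; rewrite -normr_eq0.
by rewrite (eqP (f0 i (mem_index_enum i))).
Qed.

HB.instance Definition _ := Lmodule_isNormed.Build R {ffun 'I_n -> V}
  ffun_normD ffun_normZ ffun_norm_eq0.

End FfunNorm.

Section Calculus.
Context (R : realType).

(* C^n for V of finite dimension, where the continuity of x |-> 'd f x amounts
   to that of x |-> 'd f x v for every v. *)
Fixpoint Cn (V : normedModType R) (n : nat) (f : V -> R) : Prop :=
  if n is n'.+1 then
    (forall x, differentiable f x) /\ (forall v, Cn n' (fun x => 'd f x v))
  else continuous f.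

Definition smooth (V : normedModType R) (f : V -> R) := forall n, Cn n f.

(* z is an eigenvalue of the C-linear extension of f to the complexification
   of V, with eigenvector u + i w. *)
Definition complex_eigenvalue (V : lmodType R) (f : V -> V) (z : R[i]) :=
  exists u w : V, [/\ (u, w) != (0, 0),
    f u = complex.Re z *: u - complex.Im z *: w &
    f w = complex.Im z *: u + complex.Re z *: w].

Definition steady_state (V : zmodType) (F : V -> V) (z : V) := F z = 0.

Definition linearly_stable (V : normedModType R) (F : V -> V) (z : V) :=
  forall l : R[i], complex_eigenvalue ('d F z) l -> complex.Re l < 0.

End Calculus.

Section Constrained.
Context (R : realType) (H : finNormedModType R) (dot : {dot H for idfun}).

(* The Riesz representative of 'd f x (0 if there is none). *)
Definition gradient (f : H -> R) (x : H) : H :=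
  xget 0 [set g | forall v, 'd f x v = dot g v].

Definition hessian (f : H -> R) (x : H) : H -> H := 'd (gradient f) x.

(* A tuple A = (a_1, ..., a_p) of vectors acting on R^p, its transpose
   A^T v, the matrix A^T B, and the operator v v^T. *)
Definition tapp p (A : 'I_p -> H) (t : 'cV[R]_p) : H := \sum_i t i 0 *: A i.

Definition ttr p (A : 'I_p -> H) (v : H) : 'cV[R]_p := \col_i dot v (A i).

Definition tgram p q (A : 'I_p -> H) (B : 'I_q -> H) : 'M[R]_(p, q) :=
  \matrix_(i, j) dot (B j) (A i).

Definition outer (v w : H) : H := dot v w *: v.

Fact ttr_is_linear p (A : 'I_p -> H) : linear (ttr A).
Proof.
by move=> a u v; apply/colP => i; rewrite !mxE linearDl linearZl_LR.
Qed.

HB.instance Definition _ p (A : 'I_p -> H) :=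
  GRing.isLinear.Build R H 'cV[R]_p *:%R (ttr A) (ttr_is_linear A).

Context (m : nat) (c : 'I_m -> H -> R).

Definition on_manifold (x : H) := forall l, c l x = 0.

Definition Amx (x : H) (l : 'I_m) : H := gradient (c l) x.

Definition hess_c (x eta : H) (l : 'I_m) : H := hessian (c l) x eta.

Definition tangent (x : H) : {vspace H} := lker (linfun (ttr (Amx x))).

Lemma mem_tangent x v : (v \in tangent x) = (ttr (Amx x) v == 0).
Proof. by rewrite memv_ker lfunE. Qed.

(* (A(x)^T A(x))^-1 A(x)^T v *)
Definition multiplier (x v : H) : 'cV[R]_m :=
  invmx (tgram (Amx x) (Amx x)) *m ttr (Amx x) v.

Definition proj_tangent (x v : H) : H := v - tapp (Amx x) (multiplier x v).

Definition rgrad (E : H -> R) (x : H) : H := proj_tangent x (gradient E x).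

(* The Riemannian Hessian; it is meant to be applied to eta in tangent x. *)
Definition rhess (E : H -> R) (x eta : H) : H :=
  proj_tangent x
    (hessian E x eta - tapp (hess_c x eta) (multiplier x (gradient E x))).

Definition rhess_ext (E : H -> R) (x eta : H) : H :=
  rhess E x (proj_tangent x eta).

Definition neg_def_on (U : {vspace H}) (f : H -> H) :=
  forall v, v \in U -> v != 0 -> dot (f v) v < 0.

Definition has_index (E : H -> R) (x : H) (n : nat) :=
  (exists U : {vspace H},
     [/\ (U <= tangent x)%VS, neg_def_on U (rhess E x) & \dim U = n]) /\
  (forall U : {vspace H},
     (U <= tangent x)%VS -> neg_def_on U (rhess E x) -> (\dim U <= n)%N).

Definition saddle (E : H -> R) (k : nat) (x : H) :=
  [/\ on_manifold x, rgrad E x = 0 & has_index E x k].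

(* lam lists the eigenvalues, with multiplicity, of the operator that f induces
   on U.  Multiplicity is the dimension of the eigenspace, so this is meant for
   symmetric operators. *)
Definition eigenvalues_on (U : {vspace H}) (f : H -> H) n (lam : 'I_n -> R) :=
  forall a : R, exists W : {vspace H},
    (forall v, v \in W <-> v \in U /\ f v = a *: v) /\
    \dim W = #|[pred i | lam i == a]|.

Definition invertible_on (U : {vspace H}) (f : H -> H) :=
  forall w, w \in U -> exists! v, v \in U /\ f v = w.

Context (k : nat) (E : H -> R) (mu : R).

Definition rhs_x (x : H) (v : 'I_k -> H) : H :=
  - (rgrad E x - \sum_i 2 *: outer (v i) (rgrad E x))
  - mu *: \sum_l c l x *: gradient (c l) x.

Definition rhs_v (x : H) (v : 'I_k -> H) (i : 'I_k) : H :=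
  let h := rhess_ext E x (v i) in
  - (h - outer (v i) h - \sum_(j < k | (j < i)%N) 2 *: outer (v j) h)
  - tapp (Amx x) (invmx (tgram (Amx x) (Amx x)) *m
                  ttr (hess_c x (rhs_x x v)) (v i)).

Definition saddle_dynamics (z : H * {ffun 'I_k -> H}) : H * {ffun 'I_k -> H} :=
  (rhs_x z.1 z.2, [ffun i => rhs_v z.1 z.2 i]).

End Constrained.

(* Main.v *)
From HB Require Import structures.
Require Import Defs.
From mathcomp Require Import all_boot all_order all_algebra.
From mathcomp Require Import complex.
From mathcomp Require Import all_classical all_reals all_analysis.
From mathcomp Require Import ring lra.
Import Order.TTheory GRing.Theory Num.Theory.
Import numFieldNormedType.Exports.
Local Open Scope ring_scope.

Set Implicit Arguments.
Unset Strict Implicit.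
Unset Printing Implicit Defensive.

(** Let S be the Riemannian Hessian at x, v_1, ..., v_k the given directions and
    a_i = <v_i, S v_i>.

    Steady states.  At rest the equation for v_i says that S v_i is a
    combination of v_i and of twice its own components along v_1, ..., v_(i-1).
    Together with the symmetry and the invertibility of S this forces, by
    induction on i, the v_i to be orthonormal eigenvectors of S
    (steady_eigenvectors).  Then I - sum_i 2 v_i v_i^T is a reflection, so the
    equation for x gives grad E(x) = 0 (reflection_inj).

    Jacobian.  Since grad E(x) = 0, the derivative of grad E at x is S itself:
    its tangential part is S by the definition of S, and its normal part
    vanishes because A(y)^T grad E(y) = 0 for all y near x (is_diff_rgrad).
    The x-equation does not depend on the v_i to first order, hence the Jacobian
    J is block triangular (jacobian_x, jacobian_v).  On the x-block, the v_i
    are eigenvectors with eigenvalue a_i, an eigenvector of S orthogonal to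
    all v_i with eigenvalue b has eigenvalue - b, and A A^T contributes
    - mu A A^T in the normal directions.  The v-block is triangular in turn,
    with eigenvalues a_i (normal directions), 2 a_i, a_i + a_j for j < i, and
    a_i - b for every other eigenvalue b of S.

    Stability therefore amounts to a_1 < ... < a_k < 0 together with S > 0 on
    the orthogonal complement of the v_i in the tangent space.  For the
    necessity of these conditions explicit real eigenvectors of J suffice
    (stable_eigenvalue_lt0, stable_eigenvalue_incr, stable_complement_gt0);
    for their sufficiency the components of a complex eigenvector are shown to
    vanish one after the other (saddle_stable).

    Index.  The list lam of eigenvalues provides an orthonormal eigenbasis of
    the tangent space (orthonormal_eigenbasis), so the index is the number of
    negative lam_l (index_of_eigenbasis).  A counting argument on the sorted
    list then turns the condition above into a_i = lam_i and index k
    (lowest_eigenvalues), and conversely (card_neg_sign).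

    The analytic input is the symmetry of second derivatives (schwarz) and the
    differentiability of the right-hand side, which rests on coordinates in an
    orthonormal basis and on the cofactor formula for (A^T A)^-1. *)

(** * Orthonormal families in a Euclidean space *)

Section InnerProduct.
Context (R : realType) (H : finNormedModType R) (dot : {dot H for idfun}).

Lemma dotC u v : dot u v = dot v u.
Proof. by rewrite hermC expr0 mul1r. Qed.

Lemma dotDl u v w : dot (u + v) w = dot u w + dot v w.
Proof. exact: linearDl. Qed.
Lemma dotDr u v w : dot u (v + w) = dot u v + dot u w.
Proof. exact: linearDr. Qed.
Lemma dotBl u v w : dot (u - v) w = dot u w - dot v w.
Proof. exact: linearBl. Qed.
Lemma dotBr u v w : dot u (v - w) = dot u v - dot u w.
Proof. exact: linearBr. Qed.
Lemma dotNl u v : dot (- u) v = - dot u v.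
Proof. exact: linearNl. Qed.
Lemma dotNr u v : dot u (- v) = - dot u v.
Proof. exact: linearNr. Qed.
Lemma dotZl a u v : dot (a *: u) v = a * dot u v.
Proof. by rewrite linearZl_LR. Qed.
Lemma dotZr a u v : dot u (a *: v) = a * dot u v.
Proof. by rewrite linearZr_LR. Qed.
Lemma dot0l v : dot 0 v = 0.
Proof. exact: linear0l. Qed.
Lemma dot0r v : dot v 0 = 0.
Proof. exact: linear0r. Qed.
Lemma dot_suml I r (P : pred I) (f : I -> H) v :
  dot (\sum_(i <- r | P i) f i) v = \sum_(i <- r | P i) dot (f i) v.
Proof. exact: linear_sumlz. Qed.
Lemma dot_sumr I r (P : pred I) (f : I -> H) v :
  dot v (\sum_(i <- r | P i) f i) = \sum_(i <- r | P i) dot v (f i).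
Proof. exact: linear_sumr. Qed.

Lemma dot_gt0 u : u != 0 -> 0 < dot u u.
Proof. exact: neq0_dnorm_gt0. Qed.

Lemma dot_ge0 u : 0 <= dot u u.
Proof. by have [->|/dot_gt0/ltW//] := eqVneq u 0; rewrite dot0l. Qed.

Lemma dot_eq0 u : (dot u u == 0) = (u == 0).
Proof.
by have [->|/dot_gt0/gt_eqF//] := eqVneq u 0; rewrite dot0l eqxx.
Qed.

Lemma outerZ p a u : outer dot p (a *: u) = (a * dot p u) *: p.
Proof. by rewrite /outer dotZr. Qed.

Definition orthonormal_family n (e : 'I_n -> H) :=
  forall i j, dot (e i) (e j) = (i == j)%:R.

Lemma orthonormal_sum n (e : 'I_n -> H) (a : 'I_n -> R) i :
  orthonormal_family e -> dot (\sum_j a j *: e j) (e i) = a i.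
Proof.
move=> eo; rewrite dot_suml (bigD1 i)//= dotZl eo eqxx mulr1 big1 ?addr0//.
by move=> j ji; rewrite dotZl eo (negPf ji) mulr0.
Qed.

Lemma orthonormal_free n (e : 'I_n -> H) :
  orthonormal_family e -> free [seq e i | i <- enum 'I_n].
Proof.
move=> eo; have tP : size [seq e i | i <- enum 'I_n] == n.
  by rewrite size_map size_enum_ord.
apply/(@freeP _ _ _ (Tuple tP)) => a; rewrite (eq_bigr (fun i => a i *: e i)).
  by move=> a0 i; rewrite -(orthonormal_sum a i eo) a0 dot0l.
by move=> i _ /=; rewrite (nth_map i) ?size_enum_ord// nth_ord_enum.
Qed.

Lemma dim_span_orthonormal n (e : 'I_n -> H) :
  orthonormal_family e -> \dim <<[seq e i | i <- enum 'I_n]>> = n.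
Proof.
by move=> /orthonormal_free/eqP ->; rewrite size_map size_enum_ord.
Qed.

Lemma mem_span_family n (e : 'I_n -> H) v :
  v \in <<[seq e i | i <- enum 'I_n]>>%VS -> exists a, v = \sum_i a i *: e i.
Proof.
have tP : size [seq e i | i <- enum 'I_n] == n.
  by rewrite size_map size_enum_ord.
move=> /(@coord_span _ _ _ (Tuple tP)) ->; eexists; apply: eq_bigr => i _ /=.
by rewrite (nth_map i) ?size_enum_ord// nth_ord_enum.
Qed.

Lemma span_family_sub n (e : 'I_n -> H) (U : {vspace H}) :
  (forall i, e i \in U) -> (<<[seq e i | i <- enum 'I_n]>> <= U)%VS.
Proof. by move=> eU; apply/span_subvP => _ /mapP[i _ ->]. Qed.

Lemma orthonormal_expand n (e : 'I_n -> H) (U : {vspace H}) v :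
  orthonormal_family e -> (forall i, e i \in U) -> \dim U = n ->
  v \in U -> v = \sum_i dot v (e i) *: e i.
Proof.
move=> eo eU dU vU; have : v \in <<[seq e i | i <- enum 'I_n]>>%VS.
  suff /eqP -> : <<[seq e i | i <- enum 'I_n]>>%VS == U by [].
  by rewrite eqEdim span_family_sub//= dim_span_orthonormal// dU.
move=> /mem_span_family[a ->]; apply: eq_bigr => i _.
by rewrite orthonormal_sum.
Qed.

Lemma orthonormal_eq0 n (e : 'I_n -> H) (U : {vspace H}) v :
  orthonormal_family e -> (forall i, e i \in U) -> \dim U = n ->
  v \in U -> (forall i, dot v (e i) = 0) -> v = 0.
Proof.
move=> eo eU dU vU v0; rewrite (orthonormal_expand eo eU dU vU) big1// => i _.
by rewrite v0 scale0r.
Qed.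

Definition dot_form (u : H) : H -> R^o := dot^~ u.

Fact dot_form_is_linear u : linear (dot_form u).
Proof. by move=> a v w; rewrite /dot_form dotDl dotZl. Qed.

HB.instance Definition _ u :=
  GRing.isLinear.Build R H R^o *:%R (dot_form u) (dot_form_is_linear u).

(** Gram-Schmidt: a unit vector u of U, followed by an orthonormal basis of the
    orthogonal complement of u in U. *)
Lemma orthonormal_basis (U : {vspace H}) :
  exists e : 'I_(\dim U) -> H, orthonormal_family e /\ (forall i, e i \in U).
Proof.
move: {-1}(\dim U) (eqxx (\dim U)) => n; elim: n U => [|n IHn] U dU.
  by exists (fun=> 0); split=> -[].
have U0 : U != 0%VS by rewrite -dimv_eq0 (eqP dU).
have u0 := U0; rewrite -vpick0 in u0.
pose u := (Num.sqrt (dot (vpick U) (vpick U)))^-1 *: vpick U.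
have uU : u \in U by rewrite memvZ ?memv_pick.
have uu : dot u u = 1.
  rewrite dotZl dotZr mulrA -expr2 exprVn sqr_sqrtr ?dot_ge0// mulVf//.
  by rewrite dot_eq0.
have lE v : (v \in lker (linfun (dot_form u))) = (dot v u == 0).
  by rewrite memv_ker lfunE.
pose U' := (U :&: lker (linfun (dot_form u)))%VS.
have dU' : \dim U' == n.
  have := limg_ker_dim (linfun (dot_form u)) U; rewrite -/U' (eqP dU).
  suff -> : \dim (linfun (dot_form u) @: U) = 1%N by rewrite addn1 => -[->].
  apply/eqP; rewrite eqn_leq; apply/andP; split.
    by rewrite (leq_trans (dimvS (subvf _)))// dimvf.
  rewrite lt0n dimv_eq0; apply/eqP => /(congr1 (fun V : {vspace R^o} => (1 : R^o) \in V)).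
  rewrite memv0 oner_eq0 => /negP; apply; apply/memv_imgP; exists u => //.
  by rewrite lfunE /= /dot_form uu.
have [e [eo eU']] := IHn _ dU'.
have eU i : e i \in U /\ dot (e i) u = 0.
  by have := eU' i; rewrite memv_cap lE => /andP[-> /eqP].
exists (fun i : 'I_n.+1 => if unlift ord0 i is Some j then e j else u).
split=> [i j|i]; last by case: unliftP => [l _|_]//; have [] := eU l.
case: unliftP => [i'|] ->; case: unliftP => [j'|] ->.
- by rewrite eo (inj_eq lift_inj).
- by have [_ ->] := eU i'; rewrite eq_sym (negPf (neq_lift _ _)).
- by rewrite dotC; have [_ ->] := eU j'; rewrite (negPf (neq_lift _ _)).
- by rewrite uu eqxx.
Qed.

End InnerProduct.

(** * Eigenbases and index of a symmetric operator *)

Section Spectral.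
Context (R : realType) (H : finNormedModType R) (dot : {dot H for idfun}).
Context (T : {vspace H}) (n : nat).

Lemma eigenvectors_orthogonal (S : H -> H) u w a b :
  dot (S u) w = dot u (S w) -> S u = a *: u -> S w = b *: w -> a != b ->
  dot u w = 0.
Proof.
move=> sym Su Sw ab; apply/eqP; move: sym.
rewrite Su Sw dotZl dotZr => /eqP; rewrite -subr_eq0 -mulrBl mulf_eq0 subr_eq0.
by rewrite (negPf ab).
Qed.

(** Bases of the eigenspaces fit together: the i-th vector is taken from an
    orthonormal basis of the eigenspace of lam i, at the rank of i among the
    indices with the same eigenvalue.  The multiplicities stored in lam are the
    dimensions of the eigenspaces, so no index overflows. *)
Lemma orthonormal_eigenbasis (S : H -> H) (lam : 'I_n -> R) :
  {in T &, forall u w, dot (S u) w = dot u (S w)} ->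
  eigenvalues_on T S lam ->
  exists e : 'I_n -> H, [/\ orthonormal_family dot e, forall i, e i \in T &
                            forall i, S (e i) = lam i *: e i].
Proof.
move=> sym /boolp.choice[W WP].
have /boolp.choice[B BP] a : exists B : nat -> H,
    (forall p, (p < \dim (W a))%N -> B p \in W a) /\
    (forall p q, (p < \dim (W a))%N -> (q < \dim (W a))%N ->
       dot (B p) (B q) = (p == q)%:R).
  have [f [fo fW]] := orthonormal_basis dot (W a).
  (* The family is indexed by nat, padded by 0, to avoid dependent types. *)
  exists (fun p => if insub p is Some i then f i else 0).
  split=> [p pW|p q pW qW]; first by rewrite insubT.
  by rewrite !insubT fo.
pose A i := [pred j | lam j == lam i].
pose r (i : 'I_n) := index i (enum (A i)).
have rlt i : (r i < \dim (W (lam i)))%N.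
  have [_ ->] := WP (lam i).
  by rewrite cardE index_mem mem_enum inE.
pose e i := B (lam i) (r i).
have eP i : e i \in T /\ S (e i) = lam i *: e i.
  by have [WE _] := WP (lam i); apply/WE; have [+ _] := BP (lam i); apply.
exists e; split=> [i j|i|i]; [|exact: (eP i).1|exact: (eP i).2].
have [ij|ij] := eqVneq (lam i) (lam j); last first.
  rewrite (eigenvectors_orthogonal _ (eP i).2 (eP j).2 ij).
    by case: (eqVneq i j) ij => // ->; rewrite eqxx.
  by rewrite sym ?(eP _).1.
have := rlt j; rewrite /e /r /A -ij => rj.
have [_ ->] := BP (lam i); [|exact: rlt|exact: rj].
have [->|ne] := eqVneq i j; first by rewrite !eqxx.
congr (_%:R); apply/eqP; rewrite eqb0; apply: contra ne => /eqP ri.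
have mi : i \in enum [pred l | lam l == lam i] by rewrite mem_enum inE.
have mj : j \in enum [pred l | lam l == lam i] by rewrite mem_enum inE ij.
by rewrite -(nth_index i mi) ri nth_index.
Qed.

Context (S : {linear H -> H}) (e : 'I_n -> H) (lam : 'I_n -> R).
Hypotheses (eo : orthonormal_family dot e) (eT : forall i, e i \in T)
  (Se : forall i, S (e i) = lam i *: e i) (dimT : \dim T = n).

Let sub_family (A : {set 'I_n}) (p : 'I_#|A|) : H := e (enum_val p).

Let sub_family_orthonormal A : orthonormal_family dot (@sub_family A).
Proof. by move=> p q; rewrite eo (inj_eq enum_val_inj). Qed.

Let subspan (A : {set 'I_n}) :=
  <<[seq @sub_family A p | p <- enum 'I_#|A|]>>%VS.

Let subspan_sub A : (subspan A <= T)%VS.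
Proof. by apply: span_family_sub => p; exact: eT. Qed.

Let subspan_form A v : v \in subspan A -> exists a : 'I_#|A| -> R,
  v = \sum_p a p *: sub_family p /\
  dot (S v) v = \sum_p lam (enum_val p) * a p ^+ 2.
Proof.
move=> /mem_span_family[a ->]; exists a; split=> //.
rewrite dot_sumr; apply: eq_bigr => p _.
rewrite dotZr linear_sum /=.
rewrite (eq_bigr (fun q => (a q * lam (enum_val q)) *: sub_family q)).
  by rewrite orthonormal_sum// mulrA -expr2 mulrC.
by move=> q _; rewrite linearZ/= Se scalerA.
Qed.

(** The eigenvectors with negative eigenvalue span a negative definite subspace;
    the others span a nonnegative one of complementary dimension, which meets
    every subspace of larger dimension. *)
Lemma index_of_eigenbasis :
  (forall i, lam i != 0) ->
  (exists U : {vspace H}, [/\ (U <= T)%VS, neg_def_on dot U S &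
     \dim U = #|[set i | (lam i < 0)%R]|]) /\
  (forall U : {vspace H}, (U <= T)%VS -> neg_def_on dot U S ->
     (\dim U <= #|[set i | (lam i < 0)%R]|)%N).
Proof.
move=> lam0; set A := [set i | lam i < 0]; split.
  exists (subspan A); split=> //; last exact: dim_span_orthonormal.
  move=> v /subspan_form[a [vE ->]] v0; rewrite lt_neqAle; apply/andP; split.
    apply: contra v0; rewrite -oppr_eq0 -sumrN psumr_eq0 => [/allP a0|p _].
      rewrite vE big1// => p _; have := a0 p (mem_index_enum p).
      rewrite /= oppr_eq0 mulf_eq0 (negPf (lam0 _)) sqrf_eq0 => /eqP ->.
      by rewrite scale0r.
    rewrite -mulNr mulr_ge0 ?sqr_ge0// oppr_ge0 ltW//.
    by have := enum_valP p; rewrite inE.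
  apply: sumr_le0 => p _; rewrite mulr_le0_ge0 ?sqr_ge0// ltW//.
  by have := enum_valP p; rewrite inE.
move=> U UT Uneg; rewrite leqNgt; apply/negP => dU.
have : (0 < \dim (U :&: subspan (~: A)))%N.
  have := dimv_sum_cap U (subspan (~: A)).
  have := dimvS (_ : U + subspan (~: A) <= T)%VS.
  rewrite subv_add UT subspan_sub dimT => /(_ isT) le1 eq1.
  have dC : \dim (subspan (~: A)) = #|~: A| by exact: dim_span_orthonormal.
  rewrite dC in eq1; have := cardsC A; rewrite card_ord => cA.
  rewrite lt0n; apply/eqP => d0; rewrite d0 addn0 in eq1.
  rewrite eq1 in le1; have := leq_trans le1 (eq_leq (esym cA)).
  by rewrite leq_add2r leqNgt dU.
rewrite lt0n dimv_eq0 -vpick0; set v := vpick _ => v0.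
have := memv_pick (U :&: subspan (~: A)); rewrite memv_cap -/v => /andP[vU].
move=> /subspan_form[a [_ vE]]; have := Uneg _ vU v0; rewrite vE ltNge => /negP.
apply; apply: sumr_ge0 => p _; rewrite mulr_ge0 ?sqr_ge0//.
by have := enum_valP p; rewrite !inE -leNgt.
Qed.

End Spectral.

(** * Spectrum of the linearized dynamics *)

Lemma ord_ltn_eqF k (i j : 'I_k) : (i < j)%N -> (i == j) = false.
Proof. by move=> ij; rewrite -val_eqE ltn_eqF. Qed.

(** J stands for the Jacobian at a steady state, S for the Riemannian Hessian,
    Q for its extension by 0 to the normal directions and A for the constraint
    gradients; J_x and J_v are the formulas for J obtained by differentiation. *)
Section LinearStability.
Context (R : realType) (H : finNormedModType R) (dot : {dot H for idfun}).
Context (m k : nat) (T : {vspace H}) (A : 'I_m -> H) (v : 'I_k -> H) (al : 'I_k -> R).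
Context (S Q : {linear H -> H}) (mu : R).
Context (J : {linear (H * {ffun 'I_k -> H})%type -> (H * {ffun 'I_k -> H})%type}).

Hypothesis memT : forall u, u \in T <-> forall l, dot u (A l) = 0.
Hypothesis S_mem : forall u, S u \in T.
Hypothesis S_sym : {in T &, forall u w, dot (S u) w = dot u (S w)}.
Hypothesis Q_mem : forall u, Q u \in T.
Hypothesis Q_S : {in T, Q =1 S}.
Hypothesis Q_adj : forall p u, p \in T -> dot p (Q u) = dot (S p) u.
Hypothesis v_mem : forall i, v i \in T.
Hypothesis vo : orthonormal_family dot v.
Hypothesis Sv : forall i, S (v i) = al i *: v i.
Hypothesis mu_gt0 : 0 < mu.
Hypothesis J_x : forall xi w, (J (xi, w)).1 =
  - (S xi - \sum_i 2 *: outer dot (v i) (S xi))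
  - mu *: \sum_l dot xi (A l) *: A l.
Hypothesis J_v : forall w i, (J (0, w)).2 i =
  - (Q (w i) - outer dot (v i) (Q (w i))
     - \sum_(j < k | (j < i)%N) 2 *: outer dot (v j) (Q (w i)))
  + (dot (w i) (v i) * al i) *: v i + al i *: w i
  + \sum_(j < k | (j < i)%N) (2 * (dot (w j) (v i) * al i)) *: v j.

Let stable := forall l : R[i], complex_eigenvalue J l -> complex.Re l < 0.

Lemma real_eigenvalue_lt0 z a : stable -> z != 0 -> J z = a *: z -> a < 0.
Proof.
move=> st z0 Jz; apply: (st (Complex a 0)); exists z, 0; split.
- by apply: contra z0 => /eqP/(congr1 fst)/= ->.
- by rewrite /= scaler0 subr0.
- by rewrite /= scale0r scaler0 addr0 linear0.
Qed.

Lemma J_fiber_x w : (J (0, w)).1 = 0.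
Proof.
rewrite J_x linear0 big1 => [|i _]; last by rewrite /outer dot0r scale0r scaler0.
rewrite subr0 oppr0 big1 => [|l _]; last by rewrite dot0l scale0r.
by rewrite scaler0 subr0.
Qed.

(** The v-block is the lower right block of a block triangular matrix, so its
    eigenvectors are eigenvectors of J. *)
Lemma v_eigenvector_lt0 w a : stable -> w != 0 ->
  (forall i, (J (0, w)).2 i = a *: w i) -> a < 0.
Proof.
move=> st w0 Jw; apply: (real_eigenvalue_lt0 (z := (0, w))) => //.
  by apply: contra w0 => /eqP[->].
rewrite [LHS]surjective_pairing J_fiber_x; congr pair; first by rewrite scaler0.
by apply/ffunP => i; rewrite Jw ffunE.
Qed.

Lemma v_neq0 i : v i != 0.
Proof.
by rewrite -(dot_eq0 dot) vo eqxx oner_eq0.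
Qed.

Lemma Qv i : Q (v i) = al i *: v i.
Proof. by rewrite Q_S// Sv. Qed.

(** Moving v_i along itself is an eigenvector with eigenvalue 2 a_i. *)
Lemma stable_eigenvalue_lt0 : stable -> forall i, al i < 0.
Proof.
move=> st i; pose w := [ffun j => if j == i then v i else 0 : H].
have wE j : w j = if j == i then v i else 0 by rewrite ffunE.
suff : 2 * al i < 0 by rewrite pmulr_rlt0.
apply: (v_eigenvector_lt0 (w := w)) => //.
  by apply/eqP => /ffunP/(_ i)/eqP; rewrite wE eqxx ffunE (negPf (v_neq0 i)).
move=> l; rewrite J_v [X in _ + X]big1 => [|j jl]; last first.
  rewrite wE; case: eqP => [ji|]; last by rewrite dot0l mul0r mulr0 scale0r.
  by rewrite -ji vo ord_ltn_eqF// mul0r mulr0 scale0r.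
rewrite wE; case: eqP => [->|_]; last first.
  rewrite linear0 dot0l /outer dot0r !(scaler0, mul0r, scale0r, subr0, addr0).
  by rewrite big1 ?subr0 ?oppr0// => j _; rewrite dot0r scale0r scaler0.
rewrite Qv [X in _ - X]big1 => [|j ji]; last first.
  by rewrite outerZ vo ord_ltn_eqF// mulr0 scale0r scaler0.
rewrite outerZ vo eqxx mulr1 mul1r subrr subr0 oppr0 add0r addr0.
by rewrite -scalerDl mulr2n mulrDl mul1r.
Qed.

(** The infinitesimal rotation of the plane of v_i and v_j, that is
    w_i = v_j and w_j = - v_i, is an eigenvector with eigenvalue a_i - a_j. *)
Lemma stable_eigenvalue_incr : stable -> forall i j : 'I_k, (i < j)%N -> al i < al j.
Proof.
move=> st i j ij.
have nij : i != j by rewrite -val_eqE ltn_eqF.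
have nji : j == i = false by rewrite eq_sym (negPf nij).
pose w := [ffun l => if l == i then v j else if l == j then - v i else 0 : H].
have wE l : w l = if l == i then v j else if l == j then - v i else 0.
  by rewrite ffunE.
rewrite -subr_lt0; apply: (v_eigenvector_lt0 (w := w)) => //.
  by apply/eqP => /ffunP/(_ i)/eqP; rewrite wE eqxx ffunE (negPf (v_neq0 j)).
move=> l; rewrite J_v; have [->|li] := eqVneq l i.
  rewrite [X in _ + X]big1 => [|p pi]; last first.
    rewrite wE (ord_ltn_eqF pi) (ord_ltn_eqF (ltn_trans pi ij)).
    by rewrite dot0l mul0r mulr0 scale0r.
  rewrite wE eqxx Qv [X in _ - X]big1 => [|p pi]; last first.
    rewrite outerZ vo (ord_ltn_eqF (ltn_trans pi ij)).
    by rewrite mulr0 scale0r scaler0.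
  rewrite outerZ !vo nji (negPf nij) mulr0 mul0r !scale0r !subr0 !addr0.
  by rewrite scalerBl addrC.
have [->|lj] := eqVneq l j.
  rewrite [X in _ + X](bigD1 i)//= [X in _ + (_ + X)]big1 ?addr0 => [|p]; last first.
    case/andP=> pj /negPf pi; rewrite wE pi ord_ltn_eqF//.
    by rewrite dot0l mul0r mulr0 scale0r.
  have QE : Q (- v i) = - al i *: v i by rewrite linearN /= Qv scaleNr.
  rewrite !wE eqxx nji eqxx QE.
  rewrite [X in _ - X](bigD1 i)//= [X in _ - (_ + X)]big1 ?addr0 => [|p]; last first.
    case/andP=> pj /negPf pi; rewrite outerZ vo pi.
    by rewrite mulr0 scale0r scaler0.
  rewrite !outerZ dotNl !vo nji (negPf nij) !eqxx.
  rewrite oppr0 mul0r !(mulr0, mulr1, mul1r) !scale0r subr0 addr0.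
  rewrite -(scaleN1r (v i)) !scalerA.
  rewrite -scalerBl -scaleNr -!scalerDl.
  by congr (_ *: _); ring.
rewrite [X in _ + X]big1 => [|p pl]; last first.
  rewrite wE; case: (eqVneq p i) => [_|_].
    by rewrite vo eq_sym (negPf lj) mul0r mulr0 scale0r.
  case: (eqVneq p j) => _; last by rewrite dot0l mul0r mulr0 scale0r.
  by rewrite dotNl vo eq_sym (negPf li) oppr0 mul0r mulr0 scale0r.
rewrite wE (negPf li) (negPf lj).
rewrite linear0 dot0l /outer dot0r !(scaler0, mul0r, scale0r, subr0, addr0).
by rewrite big1 ?subr0 ?oppr0// => p _; rewrite dot0r scale0r scaler0.
Qed.

(** The x-block has the eigenvector u with eigenvalue - b.  If - b is not an
    eigenvalue of the v-block, then J_vv + b is surjective and u extends to an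
    eigenvector (u, w) of J; otherwise - b has an eigenvector (0, w).  In both
    cases - b is an eigenvalue of J. *)
Lemma stable_complement_gt0 u b : stable -> u \in T -> u != 0 ->
  (forall i, dot (v i) u = 0) -> S u = b *: u -> 0 < b.
Proof.
move=> st uT u0 uv Su; rewrite -oppr_lt0.
have Ju w : (J (u, w)).1 = - b *: u.
  rewrite J_x Su big1 => [|i _]; last by rewrite outerZ uv mulr0 scale0r scaler0.
  rewrite subr0 big1 => [|l _]; last by rewrite (memT u).1// scale0r.
  by rewrite scaler0 subr0 scaleNr.
pose K w := (J (0, w)).2 + b *: w.
have K_lin : linear K.
  move=> a w1 w2; rewrite /K.
  have -> : (0, a *: w1 + w2) = a *: (0, w1) + (0, w2) :> (H * {ffun 'I_k -> H})%type.
    by apply: injective_projections => /=; rewrite ?scaler0 ?addr0.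
  by rewrite linearP /= !scalerDr !scalerA [b * a]mulrC addrACA.
pose KL : {linear _ -> _} := HB.pack K (GRing.isLinear.Build _ _ _ _ K K_lin).
have [|] := eqVneq (lker (linfun KL)) 0%VS => [/eqP K0|].
  have := lker0_lfunVK K0 (- (J (u, 0)).2); set w := (linfun KL)^-1%VF _.
  rewrite lfunE /= /K => Kw.
  apply: (real_eigenvalue_lt0 (z := (u, w))) => //; first by apply: contra u0 => /eqP[->].
  rewrite [LHS]surjective_pairing Ju; congr pair.
  have -> : (u, w) = (u, 0) + (0, w).
    by apply: injective_projections => /=; rewrite ?addr0 ?add0r.
  rewrite linearD; apply: (addIr (b *: w)) => /=.
  by rewrite -addrA Kw subrr add0r scaleNr addNr.
rewrite -vpick0; set w := vpick _ => w0.
have := memv_pick (lker (linfun KL)); rewrite memv_ker lfunE /= /K -/w => /eqP Kw.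
apply: (v_eigenvector_lt0 (w := w)) => // i.
move/ffunP: Kw => /(_ i); rewrite !ffunE => /eqP; rewrite addr_eq0 => /eqP ->.
by rewrite scaleNr.
Qed.

(** If a linear form is a left eigenvector with real eigenvalue L < 0, then its
    values p, q at the real and imaginary part of an eigenvector with eigenvalue
    a + ib satisfy L (p + iq) = (a + ib) (p + iq); as L < 0 <= a, both vanish. *)
Lemma complex_eigenvector_coord0 (L a b p q : R) : L < 0 -> 0 <= a ->
  L * p = a * p - b * q -> L * q = b * p + a * q -> p = 0 /\ q = 0.
Proof.
move=> L0 a0 Lp Lq.
have : (a - L) * (p ^+ 2 + q ^+ 2) = 0.
  have -> : (a - L) * (p ^+ 2 + q ^+ 2) =
    (a * p - L * p) * p + (a * q - L * q) * q by ring.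
  by rewrite Lp Lq; ring.
move/eqP; rewrite mulf_eq0 gt_eqF/= ?paddr_eq0 ?sqr_ge0 ?sqrf_eq0 //; last lra.
by case/andP => /eqP -> /eqP ->.
Qed.

(* An orthonormal eigenbasis f of T that begins with v_1, ..., v_k. *)
Context (n : nat) (f : 'I_n -> H) (lam : 'I_n -> R) (kn : (k <= n)%N).
Hypotheses (fo : orthonormal_family dot f) (fT : forall l, f l \in T)
  (dimT : \dim T = n) (Sf : forall l, S (f l) = lam l *: f l)
  (fv : forall i, f (widen_ord kn i) = v i)
  (lam_neg : forall i j : 'I_n, (i < j)%N -> (i < k)%N -> lam i < lam j)
  (lam_sign : forall l : 'I_n, if (l < k)%N then lam l < 0 else 0 < lam l).

Lemma eigenvalue_v i : lam (widen_ord kn i) = al i.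
Proof.
have := Sf (widen_ord kn i); rewrite fv Sv => /eqP.
rewrite -subr_eq0 -scalerBl scaler_eq0 (negPf (v_neq0 _)) orbF subr_eq0.
by move/eqP.
Qed.

Lemma dot_fv l i : dot (f l) (v i) = (l == widen_ord kn i)%:R.
Proof. by rewrite -fv fo. Qed.

Lemma lt_widen_ord (l : 'I_n) : (l < k)%N -> exists i, l = widen_ord kn i.
Proof. by move=> lk; exists (Ordinal lk); apply: val_inj. Qed.

(** The reflection changes the sign of S exactly on the span of the v_i, so f l
    is a left eigenvector of the restriction of the x-block to T. *)
Lemma dot_Jx l xi w : xi \in T ->
  dot (f l) (J (xi, w)).1 = (if (l < k)%N then lam l else - lam l) * dot (f l) xi.
Proof.
move=> xiT; rewrite J_x dotBr dotNr dotBr dotZr [X in mu * X]dot_sumr.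
rewrite [X in mu * X]big1 => [|p _]; last by rewrite (memT _).1// scale0r dot0r.
rewrite mulr0 subr0 dot_sumr -S_sym// Sf dotZl.
case: ifPn => lk.
  have [i ->] := lt_widen_ord lk; rewrite (bigD1 i)//= big1 => [|j ji].
    by rewrite /outer dotZr dotZr -fv fo eqxx -S_sym// Sf dotZl mulr1; ring.
  rewrite /outer !dotZr dot_fv -val_eqE /= val_eqE eq_sym (negPf ji).
  by rewrite !mulr0.
rewrite big1 => [|j _]; first by ring.
rewrite /outer !dotZr dot_fv (_ : _ == _ = false) ?mulr0//.
by apply/negbTE; apply: contra lk => /eqP ->; rewrite /=.
Qed.

(* K is the operator A A^T. *)
Let K u := \sum_l dot u (A l) *: A l.

Lemma dot_K p q : dot (K p) q = \sum_l dot p (A l) * dot q (A l).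
Proof. by rewrite dot_suml; apply: eq_bigr => l _; rewrite dotZl [dot (A l) q]dotC. Qed.

Lemma dot_K_tangent p t : t \in T -> dot (K p) t = 0.
Proof. by move=> tT; rewrite dot_K big1// => l _; rewrite (memT t).1// mulr0. Qed.

Lemma dot_K_J p z : dot (K p) (J z).1 = - mu * dot (K p) (K z.1).
Proof.
rewrite [z in J z]surjective_pairing J_x -/(K z.1) dotBr dotNr dotZr.
rewrite dot_K_tangent ?oppr0 ?add0r ?mulNr//.
by rewrite rpredB ?rpred_sum// => i _; rewrite !rpredZ.
Qed.

Lemma K_eq0 p : K p = 0 -> p \in T.
Proof.
move=> Kp; have := dot_K p p; rewrite Kp dot0l => /esym/eqP.
rewrite psumr_eq0 => [/allP p0|l _]; last by rewrite -expr2 sqr_ge0.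
by apply/memT => l; have := p0 l (mem_index_enum l); rewrite -expr2 sqrf_eq0 => /eqP.
Qed.

Lemma dot_Jv p (w : {ffun 'I_k -> H}) (i : 'I_k) :
  (forall j : 'I_k, (j < i)%N -> w j = 0) ->
  dot p ((J (0, w)).2 i) =
  - (dot p (Q (w i)) - dot (v i) (Q (w i)) * dot p (v i)
     - \sum_(j < k | (j < i)%N) 2 * (dot (v j) (Q (w i)) * dot p (v j)))
  + al i * dot (w i) (v i) * dot p (v i) + al i * dot p (w i).
Proof.
move=> w0; rewrite J_v [X in _ + X]big1 ?addr0 => [|j ji]; last first.
  by rewrite w0// dot0l mul0r mulr0 scale0r.
rewrite !dotDr dotNr !dotBr !dotZr dot_sumr [dot _ _ * al i]mulrC.
by under eq_bigr do rewrite !dotZr.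
Qed.

(** If the earlier components of w vanish, only the diagonal block of the
    triangular v-block acts on w_i; on normal directions it is a_i. *)
Lemma dot_Jv_normal l (w : {ffun 'I_k -> H}) (i : 'I_k) :
  (forall j : 'I_k, (j < i)%N -> w j = 0) ->
  dot (A l) ((J (0, w)).2 i) = al i * dot (A l) (w i).
Proof.
move=> w0; have AT t : t \in T -> dot (A l) t = 0 by move=> tT; rewrite dotC (memT t).1.
rewrite dot_Jv// (AT (Q _))// (AT (v _))// big1 => [|j _]; last first.
  by rewrite (AT (v _))// !mulr0.
by rewrite !mulr0 !subr0 oppr0 !add0r.
Qed.

(** The diagonal block is symmetric and diagonal in the basis f. *)
Lemma dot_Jv_tangent (l : 'I_n) (w : {ffun 'I_k -> H}) (i : 'I_k) :
  (forall j : 'I_k, (j < i)%N -> w j = 0) ->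
  dot (f l) ((J (0, w)).2 i) =
  (if (l < i)%N then lam l + al i else
   if l == widen_ord kn i then 2 * al i else al i - lam l) * dot (f l) (w i).
Proof.
move=> w0; have fQ p : dot (f p) (Q (w i)) = lam p * dot (f p) (w i).
  by rewrite Q_adj// Sf dotZl.
rewrite dot_Jv// [dot (w i) _]dotC fQ -!fv !fQ fo.
have [li|il|li] := ltngtP l i.
- have lk := ltn_trans li (ltn_ord i); have [j lj] := lt_widen_ord lk.
  rewrite (bigD1 j) /=; last by rewrite lj in li.
  rewrite big1 => [|p /andP[pi pj]]; last first.
    rewrite -!fv fo lj (_ : (_ == _) = false) ?mulr0//.
    by rewrite -val_eqE /= val_eqE eq_sym (negPf pj).
  rewrite -!fv fQ -lj fo eqxx (_ : (_ == _) = false) /=; first by ring.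
  by rewrite -val_eqE /= ltn_eqF.
- rewrite big1 => [|p pi]; last first.
    rewrite -!fv fo (_ : (_ == _) = false) ?mulr0//.
    by rewrite -val_eqE /= gtn_eqF// (ltn_trans pi).
  by rewrite (_ : (_ == _) = false) /=; [ring|rewrite -val_eqE /= gtn_eqF].
- have -> : l = widen_ord kn i by apply/eqP; rewrite -val_eqE /= li.
  rewrite eqxx big1 => [|p pi]; last first.
    rewrite -!fv fo (_ : (_ == _) = false) ?mulr0//.
    by rewrite -val_eqE /= gtn_eqF.
  by rewrite eigenvalue_v /=; ring.
Qed.

(** Let z1 + i z2 be an eigenvector whose eigenvalue has real part a >= 0, with
    x-components x1 + i x2.  Testing the x-equation against K x1 and K x2 gives
    - mu (|K x1|^2 + |K x2|^2) = a (<K x1, x1> + <K x2, x2>), where the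
    right-hand side is nonnegative; so K x1 = K x2 = 0, and x1, x2 are tangent.  Then the coordinates along the left
    eigenvectors f l vanish, first in x, then successively in w_1, ..., w_k. *)
Lemma saddle_stable : stable.
Proof.
case=> a b [z1 [z2 [z0 Jz1 Jz2]]] /=; rewrite ltNge; apply: contra z0 => a0.
rewrite /= in Jz1 Jz2.
have Jx1 : (J z1).1 = a *: z1.1 - b *: z2.1 by rewrite Jz1.
have Jx2 : (J z2).1 = b *: z1.1 + a *: z2.1 by rewrite Jz2.
have [x1T x2T] : z1.1 \in T /\ z2.1 \in T.
  have : - mu * (dot (K z1.1) (K z1.1) + dot (K z2.1) (K z2.1)) =
         a * (dot (K z1.1) z1.1 + dot (K z2.1) z2.1).
    rewrite mulrDr -!dot_K_J Jx1 Jx2 dotBr dotDr !dotZr.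
    have -> : dot (K z2.1) z1.1 = dot (K z1.1) z2.1.
      by rewrite !dot_K; apply: eq_bigr => l _; rewrite mulrC.
    by ring.
  have q0 p : 0 <= dot (K p) p.
    by rewrite dot_K sumr_ge0// => l _; rewrite -expr2 sqr_ge0.
  have := mulr_ge0 a0 (addr_ge0 (q0 z1.1) (q0 z2.1)) => /[swap] <-.
  rewrite mulNr oppr_ge0 pmulr_rle0// => le0.
  have : dot (K z1.1) (K z1.1) + dot (K z2.1) (K z2.1) == 0.
    by rewrite eq_le le0 addr_ge0 ?dot_ge0.
  rewrite paddr_eq0 ?dot_ge0// !dot_eq0 => /andP[/eqP K1 /eqP K2].
  by split; apply: K_eq0.
have fx l : dot (f l) z1.1 = 0 /\ dot (f l) z2.1 = 0.
  apply: (@complex_eigenvector_coord0 (if (l < k)%N then lam l else - lam l) a b) => //.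
  - by have := lam_sign l; case: ifP => // _; rewrite oppr_lt0.
  - by rewrite -(dot_Jx _ z1.2)// -surjective_pairing Jx1 dotBr !dotZr.
  - by rewrite -(dot_Jx _ z2.2)// -surjective_pairing Jx2 dotDr !dotZr.
have x10 : z1.1 = 0.
  by apply: (orthonormal_eq0 fo fT dimT) => // l; rewrite dotC; have [] := fx l.
have x20 : z2.1 = 0.
  by apply: (orthonormal_eq0 fo fT dimT) => // l; rewrite dotC; have [] := fx l.
have z1E : z1 = (0, z1.2) by rewrite -x10 -surjective_pairing.
have z2E : z2 = (0, z2.2) by rewrite -x20 -surjective_pairing.
have Jv1 i : (J (0, z1.2)).2 i = a *: z1.2 i - b *: z2.2 i.
  by rewrite -z1E Jz1 !ffunE.
have Jv2 i : (J (0, z2.2)).2 i = b *: z1.2 i + a *: z2.2 i.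
  by rewrite -z2E Jz2 !ffunE.
have al_lt0 i : al i < 0.
  by have := lam_sign (widen_ord kn i); rewrite /= ltn_ord eigenvalue_v.
have vz i : z1.2 i = 0 /\ z2.2 i = 0.
  move: {2}(val i) (erefl (val i)) => p; elim/ltn_ind: p i => p IHp i ip.
  have w1 (j : 'I_k) : (j < i)%N -> z1.2 j = 0.
    by rewrite ip => jp; have [] := IHp _ jp _ erefl.
  have w2 (j : 'I_k) : (j < i)%N -> z2.2 j = 0.
    by rewrite ip => jp; have [] := IHp _ jp _ erefl.
  have [w1T w2T] : z1.2 i \in T /\ z2.2 i \in T.
    have AA l : dot (A l) (z1.2 i) = 0 /\ dot (A l) (z2.2 i) = 0.
      apply: (@complex_eigenvector_coord0 (al i) a b) => //.
      - by rewrite -dot_Jv_normal// Jv1 dotBr !dotZr.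
      - by rewrite -dot_Jv_normal// Jv2 dotDr !dotZr.
    by split; apply/memT => l; rewrite dotC; have [] := AA l.
  have ff l : dot (f l) (z1.2 i) = 0 /\ dot (f l) (z2.2 i) = 0.
    have := @dot_Jv_tangent l z1.2 i w1; have := @dot_Jv_tangent l z2.2 i w2.
    set L := (X in X * _); rewrite Jv1 Jv2 dotBr dotDr !dotZr => L2 L1.
    apply: (@complex_eigenvector_coord0 L a b) => //; rewrite /L.
    case: (ltngtP l i) => [li|il|li].
    + have := lam_sign l; rewrite (ltn_trans li)// => ll.
      by have := al_lt0 i; lra.
    + rewrite (_ : _ == _ = false) ?subr_lt0 -?eigenvalue_v ?lam_neg/= ?ltn_ord//.
      by rewrite -val_eqE /= gtn_eqF.
    + have -> : l = widen_ord kn i by apply/eqP; rewrite -val_eqE /= li.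
      by rewrite eqxx; have := al_lt0 i; lra.
  split; apply: (orthonormal_eq0 fo fT dimT) => // l; rewrite dotC;
    by have [] := ff l.
apply/eqP; rewrite z1E z2E; congr pair; congr pair; apply/ffunP => i;
  by rewrite ffunE; have [] := vz i.
Qed.

End LinearStability.

(** * Steady states and the ordering of the eigenvalues *)

Lemma card_ord_lt n k : (k <= n)%N -> #|[set l : 'I_n | (l < k)%N]| = k.
Proof.
move=> kn; rewrite cardsE -sum1_card (eq_bigl (fun l : 'I_n => (l < k)%N)) //.
by rewrite -(big_ord_widen n (fun=> 1%N) kn) sum_nat_const card_ord muln1.
Qed.

Section SteadyState.
Context (R : realType) (H : finNormedModType R) (dot : {dot H for idfun}).
Context (k : nat) (T : {vspace H}) (S : {linear H -> H}) (v : 'I_k -> H).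
Hypothesis S_sym : {in T &, forall u w, dot (S u) w = dot u (S w)}.
Hypothesis v_mem : forall i, v i \in T.

Lemma reflection_inj g : orthonormal_family dot v ->
  g - \sum_i 2 *: outer dot (v i) g = 0 -> g = 0.
Proof.
move=> vo g0; have vg i : dot (v i) g = 0.
  have := congr1 (dot (v i)) g0; rewrite dotBr dot_sumr dot0r (bigD1 i)//=.
  rewrite big1 => [|j ji]; last by rewrite !dotZr vo eq_sym (negPf ji) !mulr0.
  by rewrite !dotZr vo eqxx mulr1 => h; lra.
move: g0; rewrite big1 ?subr0// => i _.
by rewrite /outer vg scale0r scaler0.
Qed.

(** Induction on i.  Write b_j = <v_j, v_i> for j < i.  The products of the
    equation with v_j and with v_i give (a_i + a_j) b_j = 0 and
    sum_(j < i) a_j b_j^2 = 0, hence a_i sum_(j < i) b_j^2 = 0.  If some b_j were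
    nonzero, then a_i = 0 and a_j = - a_i = 0, so S v_j = 0, against the
    injectivity of S. *)
Lemma steady_eigenvectors :
  {in T, forall u, S u = 0 -> u = 0} ->
  (forall i, dot (v i) (v i) = 1) ->
  (forall i, S (v i) - outer dot (v i) (S (v i))
     - \sum_(j < k | (j < i)%N) 2 *: outer dot (v j) (S (v i)) = 0) ->
  orthonormal_family dot v /\
  forall i, S (v i) = dot (v i) (S (v i)) *: v i.
Proof.
move=> S_inj v1 steady; pose al i := dot (v i) (S (v i)).
have eqS i : S (v i) = al i *: v i +
    \sum_(j < k | (j < i)%N) (2 * dot (v j) (S (v i))) *: v j.
  apply/subr0_eq; rewrite -[RHS](steady i) opprD addrA; congr (_ - _).
  by apply: eq_bigr => j _; rewrite scalerA.
suff main (i : 'I_k) : (forall j : 'I_k, (j < i)%N -> dot (v j) (v i) = 0) /\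
              S (v i) = al i *: v i.
  split=> [i j|i]; last by have [] := main i.
  case: (ltngtP i j) => [ij|ji|/ord_inj ->].
  - by rewrite ord_ltn_eqF//; apply: (main j).1.
  - by rewrite eq_sym ord_ltn_eqF// dotC; apply: (main i).1.
  - by rewrite v1 eqxx.
move: {2}(val i) (erefl (val i)) => p; elim/ltn_ind: p i => p IHp i ip.
have IH (j : 'I_k) : (j < i)%N -> (forall l : 'I_k, (l < j)%N -> dot (v l) (v j) = 0) /\
    S (v j) = al j *: v j by rewrite ip => jp; apply: (IHp _ jp).
have vv (j l : 'I_k) : (j < i)%N -> (l < i)%N -> j != l -> dot (v j) (v l) = 0.
  move=> ji li; rewrite -val_eqE neq_ltn => /orP[jl|lj]; first by apply: (IH _ li).1.
  by rewrite dotC; apply: (IH _ ji).1.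
have vS (j : 'I_k) : (j < i)%N -> dot (v j) (S (v i)) = al j * dot (v j) (v i).
  by move=> ji; rewrite -S_sym// (IH _ ji).2 dotZl.
have pair0 (j : 'I_k) : (j < i)%N -> (al i + al j) * dot (v j) (v i) = 0.
  move=> ji; have := congr1 (dot (v j)) (eqS i).
  rewrite dotDr dotZr dot_sumr (bigD1 j)//= big1 => [|l /andP[li lj]]; last first.
    by rewrite dotZr vv ?mulr0// eq_sym.
  by rewrite dotZr v1 vS// => h; apply/eqP; rewrite -(subr_eq0 _ 0) subr0; apply/eqP; lra.
have ortho (j : 'I_k) : (j < i)%N -> dot (v j) (v i) = 0.
  move=> ji; apply/eqP/negPn/negP => vji.
  have al0 (l : 'I_k) : (l < i)%N -> dot (v l) (v i) != 0 -> al i = - al l.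
    move=> li vli; have /eqP := pair0 _ li.
    by rewrite mulf_eq0 (negPf vli) orbF addr_eq0 => /eqP.
  have : al i * \sum_(l < k | (l < i)%N) dot (v l) (v i) ^+ 2 = 0.
    have := congr1 (dot (v i)) (eqS i); rewrite -/(al i) dotDr dotZr v1 mulr1.
    rewrite -[LHS]addr0 => /addrI; rewrite dot_sumr => sum0.
    apply/eqP; have : - 2 * (al i * \sum_(l < k | (l < i)%N) dot (v l) (v i) ^+ 2) == 0.
      apply/eqP; apply: etrans (esym sum0); rewrite !mulr_sumr; apply: eq_bigr => l li.
      rewrite dotZr vS// [dot (v i) _]dotC.
      have [->|vli] := eqVneq (dot (v l) (v i)) 0; first by rewrite !mulr0 expr0n /= !mulr0.
      by rewrite (al0 _ li vli); ring.
    by rewrite mulf_eq0 oppr_eq0 pnatr_eq0.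
  move/eqP; rewrite mulf_eq0 psumr_eq0 => [|l _]; last exact: sqr_ge0.
  case/orP => [/eqP ali|/allP /(_ j (mem_index_enum j))]; last first.
    by rewrite ji sqrf_eq0 (negPf vji).
  have /eqP := v1 j; rewrite (S_inj (v j)) ?dot0l 1?eq_sym ?oner_eq0//.
  have := al0 _ ji vji; rewrite ali => /esym/eqP; rewrite oppr_eq0 => /eqP alj.
  by rewrite (IH _ ji).2 alj scale0r.
split=> //; rewrite [LHS]eqS big1 ?addr0// => j ji.
by rewrite vS// ortho// !mulr0 scale0r.
Qed.

Lemma eigenvectors_steady (al : 'I_k -> R) : orthonormal_family dot v ->
  (forall i, S (v i) = al i *: v i) -> forall i,
  S (v i) - outer dot (v i) (S (v i))
     - \sum_(j < k | (j < i)%N) 2 *: outer dot (v j) (S (v i)) = 0.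
Proof.
move=> vo Sv i; rewrite Sv outerZ vo eqxx mulr1 subrr sub0r big1 ?oppr0// => j ji.
by rewrite outerZ vo ord_ltn_eqF// mulr0 scale0r scaler0.
Qed.

Context (n : nat) (e : 'I_n -> H) (lam : 'I_n -> R) (kn : (k <= n)%N).
Hypotheses (eo : orthonormal_family dot e) (eT : forall l, e l \in T)
  (dimT : \dim T = n) (Se : forall l, S (e l) = lam l *: e l)
  (lam_le : forall i j : 'I_n, (i <= j)%N -> lam i <= lam j)
  (lam0 : forall l, lam l != 0).

(** Each v_i has a nonzero component along some e (s i), whence lam (s i) = a_i.
    An eigenvector e l outside the image of s has a positive eigenvalue: either
    it is orthogonal to all v_i, or it shares the eigenvalue a_i with e (s i) and
    a combination of the two is orthogonal to all v_i.  So s is increasing and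
    its image is the set of negative eigenvalues, an initial segment of the
    sorted list; hence s i = i. *)
Lemma lowest_eigenvalues (al : 'I_k -> R) : orthonormal_family dot v ->
  (forall i, S (v i) = al i *: v i) ->
  (forall i, al i < 0) -> (forall i j : 'I_k, (i < j)%N -> al i < al j) ->
  (forall u b, u \in T -> u != 0 -> (forall i, dot (v i) u = 0) ->
     S u = b *: u -> 0 < b) ->
  (forall i, lam (widen_ord kn i) = al i) /\
  (forall l : 'I_n, (k <= l)%N -> 0 < lam l).
Proof.
move=> vo Sv al_lt0 al_incr compl.
have al_inj i j : al i = al j -> i = j.
  move=> alij; apply: ord_inj; case: (ltngtP i j) => // /al_incr;
    by rewrite alij ltxx.
have v0 i : v i != 0 by rewrite -(dot_eq0 dot) vo eqxx oner_eq0.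
have /boolp.choice[s sP] i : exists l, lam l = al i /\ dot (e l) (v i) != 0.
  have [l lv|ev0] := pickP [pred l | dot (e l) (v i) != 0].
    exists l; split=> //; apply/eqP; apply: contraTT lv => ll.
    rewrite /= negbK; apply/eqP.
    by apply: (eigenvectors_orthogonal _ (Se l) (Sv i)) ll; rewrite S_sym.
  case/eqP: (v0 i); apply: (orthonormal_eq0 eo eT dimT (v_mem i)) => l.
  by rewrite dotC; apply/eqP; move/negbT: (ev0 l); rewrite /= negbK.
have lams i : lam (s i) = al i by case: (sP i).
have pos l : (forall i, l != s i) -> 0 < lam l.
  move=> ls; have [i|noal] := pickP [pred i | al i == lam l]; last first.
    apply: (compl (e l)) => //; first by rewrite -(dot_eq0 dot) eo eqxx oner_eq0.
    move=> i; apply: (eigenvectors_orthogonal _ (Sv i) (Se l)); rewrite ?S_sym//.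
    exact: negbT (noal i).
  rewrite /= => /eqP ali.
  pose u := dot (e (s i)) (v i) *: e l - dot (e l) (v i) *: e (s i).
  apply: (compl u) => //.
  - by rewrite rpredB ?rpredZ.
  - apply/eqP => /(congr1 (dot (e l)))/eqP; rewrite dotBr !dotZr !eo eqxx.
    by rewrite (negPf (ls i)) mulr0 subr0 mulr1 dot0r; apply/negP; case: (sP i).
  - move=> j; have [->|ji] := eqVneq j i.
      by rewrite dotBr !dotZr ![dot (v i) _]dotC mulrC subrr.
    have aij : al j != al i by apply: contra ji => /eqP/al_inj ->.
    have vel : dot (v j) (e l) = 0.
      by apply: (eigenvectors_orthogonal _ (Sv j) (Se l)); rewrite ?S_sym// -ali.
    have ves : dot (v j) (e (s i)) = 0.
      by apply: (eigenvectors_orthogonal _ (Sv j) (Se (s i))); rewrite ?S_sym// lams.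
    by rewrite dotBr !dotZr vel ves !mulr0 subr0.
  - rewrite linearB !linearZ /= !Se lams ali !scalerA scalerBr !scalerA.
    by rewrite scalerN scalerA ![_ * lam l]mulrC.
have s_incr (i j : 'I_k) : (i < j)%N -> (s i < s j)%N.
  move=> ij; rewrite ltnNge; apply/negP => /lam_le; rewrite !lams leNgt.
  by rewrite al_incr.
have sE (i : 'I_k) : s i = i :> nat.
  move: {2}(val i) (erefl (val i)) => p; elim/ltn_ind: p i => p IHp i ip.
  case: (ltngtP (s i) i) => // [si|is_].
    have sk := ltn_trans si (ltn_ord i).
    have ss : s (Ordinal sk) = s i :> nat.
      by rewrite (IHp (s i)) //= -ip.
    by have := s_incr (Ordinal sk) i si; rewrite ss ltnn.
  have [j jP|no] := pickP [pred j | widen_ord kn i == s j].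
    have sj : s j = i :> nat by rewrite -(eqP jP).
    case: (ltngtP j i) => [ji|ij|/ord_inj ji].
    - have := IHp j; rewrite -ip => /(_ ji j erefl); rewrite sj => ij.
      by rewrite ij ltnn in ji.
    - by have := s_incr _ _ ij; rewrite sj => /(ltn_trans is_); rewrite ltnn.
    - by rewrite ji in sj.
  have := pos (widen_ord kn i) (fun j => negbT (no j)).
  have := @lam_le (widen_ord kn i) (s i) (ltnW is_); rewrite lams => le1 lt1.
  by have := lt_le_trans lt1 le1; rewrite ltNge ltW.
have sW i : widen_ord kn i = s i by apply: ord_inj; rewrite sE.
split=> [i|l kl]; first by rewrite sW lams.
apply: pos => i; apply/eqP => li; move: kl; rewrite li sE.
by rewrite leqNgt ltn_ord.
Qed.

(** As lam is sorted, the indices of its negative entries form an initial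
    segment. *)
Lemma card_neg_sign : #|[set l | lam l < 0]| = k ->
  forall l : 'I_n, if (l < k)%N then lam l < 0 else 0 < lam l.
Proof.
set N := [set l | lam l < 0] => cN.
pose I := [set l : 'I_n | (l < k)%N].
have cI : #|I| = k by exact: card_ord_lt.
have IN : I = N.
  have down (i j : 'I_n) : (i <= j)%N -> j \in N -> i \in N.
    by move=> /lam_le ij; rewrite !inE; apply: le_lt_trans.
  have [NI|/subsetPn[j jN jI]] := boolP (N \subset I).
    by apply/esym/eqP; rewrite eqEcard NI cI cN leqnn.
  apply/eqP; rewrite eqEcard cI cN leqnn andbT; apply/fintype.subsetP => i iI.
  apply: down jN; move: iI jI; rewrite !inE -leqNgt => ik kj.
  exact: ltnW (leq_trans ik kj).
move=> l; have lIN : (l \in I) = (l \in N) by rewrite IN.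
move: lIN; rewrite !inE => lIN; case: ifPn => lk; first by rewrite -lIN.
by move: lk; rewrite lIN -leNgt lt0r lam0.
Qed.

(** The first k vectors of e are replaced by the v_i.  The signs separate the
    eigenvalues of the two groups, so they stay orthogonal. *)
Lemma extend_eigenbasis : orthonormal_family dot v ->
  (forall i, S (v i) = lam (widen_ord kn i) *: v i) ->
  (forall l : 'I_n, if (l < k)%N then lam l < 0 else 0 < lam l) ->
  exists f : 'I_n -> H, [/\ orthonormal_family dot f, forall l, f l \in T,
    forall l, S (f l) = lam l *: f l & forall i, f (widen_ord kn i) = v i].
Proof.
move=> vo Sv sgn.
pose f (l : 'I_n) := if insub (val l) is Some i then v i else e l.
have fW i : f (widen_ord kn i) = v i by rewrite /f /= valK.
have fk (l : 'I_n) : (k <= l)%N -> f l = e l.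
  by move=> kl; rewrite /f insubF// ltnNge kl.
have cas (l : 'I_n) : (exists2 i, l = widen_ord kn i & lam l < 0) \/
    ((k <= l)%N /\ 0 < lam l).
  have := sgn l; case: ltnP => [lk|kl]; last by right.
  by left; exists (Ordinal lk) => //; apply: ord_inj.
have fT l : f l \in T.
  by case: (cas l) => [[i -> _]|[kl _]]; rewrite ?fW ?fk.
have Sf l : S (f l) = lam l *: f l.
  by case: (cas l) => [[i -> _]|[kl _]]; rewrite ?fW ?fk.
exists f; split=> // l p; have [lp|lp] := eqVneq (lam l) (lam p); last first.
  rewrite (eigenvectors_orthogonal _ (Sf l) (Sf p) lp) ?S_sym//.
  by case: (eqVneq l p) lp => // ->; rewrite eqxx.
case: (cas l) (cas p) => [[i li l0]|[kl l0]] [[j pj p0]|[kp p0]].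
- by rewrite li pj !fW vo.
- by have := lt_trans l0 p0; rewrite lp ltxx.
- by have := lt_trans p0 l0; rewrite lp ltxx.
- by rewrite !fk.
Qed.

End SteadyState.

(** * Rules of differentiation *)

Local Open Scope classical_set_scope.

Section DifferentialRules.
Context (R : realType) (V W : normedModType R).
Implicit Types (f g : V -> W) (x : V).

Lemma is_diff_near0 f x : (\forall y \near x, f y = 0) -> is_diff x f 0.
Proof.
move=> f0.
have fx : f x = 0 by exact: nbhs_singleton f0.
have fo : f \o shift x = cst (f x) + (\0 : V -> W) +o_ 0 id.
  rewrite fx; apply/eqaddoP => _/posnumP[e].
  have : \forall h \near 0, f (h + x) = 0.
    by move: f0; rewrite (near_shift 0 x) subr0.
  apply: filterS => h fh; rewrite !fctE /= fh !addr0 subr0 normr0.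
  by rewrite mulr_ge0.
have c0 : continuous (\0 : V -> W) by move=> ?; exact: cst_continuous.
have d0 := diff_unique c0 fo.
apply: DiffDef; last by rewrite d0.
by apply/diff_locallyP; rewrite d0; split.
Qed.

(** Differentials are local: they only depend on the germ of the function. *)
Lemma is_diff_near_eq f g df x : (\forall y \near x, f y = g y) ->
  is_diff x f df -> is_diff x g df.
Proof.
move=> fg dfx; have h0 : \forall y \near x, (g - f) y = 0.
  by apply: filterS fg => y fgy; rewrite !fctE fgy subrr.
have := is_diffD dfx (is_diff_near0 h0).
by rewrite addr0 addrC subrK.
Qed.

Lemma is_diff_bigsum (I : Type) (r : seq I) (P : pred I) (f df : I -> V -> W) x :
  (forall i, P i -> is_diff x (f i) (df i)) ->
  is_diff x (fun y => \sum_(i <- r | P i) f i y)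
            (fun u => \sum_(i <- r | P i) df i u).
Proof.
move=> fP; elim: r => [|i r IHr].
  have -> : (fun y => \sum_(i <- [::] | P i) f i y) = cst 0.
    by apply/funext => y; rewrite big_nil.
  have -> : (fun u => \sum_(i <- [::] | P i) df i u) = 0.
    by apply/funext => y; rewrite big_nil.
  exact: is_diff_cst.
have bE (g : I -> V -> W) : (fun y => \sum_(j <- i :: r | P j) g j y) =
    if P i then g i + (fun y => \sum_(j <- r | P j) g j y)
    else fun y => \sum_(j <- r | P j) g j y.
  by apply/funext => y; rewrite big_cons; case: ifP.
rewrite !bE; case: ifP => // Pi; exact: is_diffD (fP _ Pi) IHr.
Qed.

Lemma differentiable_bigsum (I : Type) (r : seq I) (P : pred I) (f : I -> V -> W) x :
  (forall i, P i -> differentiable (f i) x) ->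
  differentiable (fun y => \sum_(i <- r | P i) f i y) x.
Proof.
move=> fP; have [] := @is_diff_bigsum I r P f (fun i => 'd (f i) x) x _ => //.
by move=> i /fP /differentiableP.
Qed.

Lemma is_diff_linear (L : {linear V -> W}) x : continuous L -> is_diff x L L.
Proof.
by move=> Lc; apply: DiffDef; [exact: linear_differentiable|exact: diff_lin].
Qed.

Lemma linear_continuous_of_bound (L : {linear V -> W}) (C : R) :
  (forall u, `|L u| <= C * `|u|) -> continuous L.
Proof.
move=> LC; apply/linear_bounded_continuous/linear_boundedP.
near=> r => u; apply: (le_trans (LC u)); rewrite ler_wpM2r//.
Unshelve. all: by end_near. Qed.

Lemma scale_is_bilinear : bilinear_for
  (GRing.Scale.Law.clone _ _ *:%R _) (GRing.Scale.Law.clone _ _ *:%R _)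
  (fun (a : R) (w : W) => a *: w).
Proof.
split=> [w|b] a c d /=; first by rewrite scalerDl scalerA.
by rewrite scalerDr !scalerA mulrC.
Qed.

Lemma is_diff_bilinear (U1 U2 : normedModType R) (B : {bilinear U1 -> U2 -> W})
    (f1 df1 : V -> U1) (f2 df2 : V -> U2) x :
  continuous (fun p => B p.1 p.2) ->
  is_diff x f1 df1 -> is_diff x f2 df2 ->
  is_diff x (fun y => B (f1 y) (f2 y))
            (fun u => B (f1 x) (df2 u) + B (df1 u) (f2 x)).
Proof.
move=> Bc d1 d2.
have dB : is_diff (f1 x, f2 x) (fun p => B p.1 p.2)
    (fun q => B (f1 x) q.2 + B q.1 (f2 x)).
  by apply: DiffDef; [exact: differentiable_bilin|rewrite diff_bilin].
exact: (is_diff_comp (is_diff_pair d1 d2) dB).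
Qed.

Lemma is_diff_scale (s ds : V -> R) f df x :
  is_diff x s ds -> is_diff x f df ->
  is_diff x (fun y => s y *: f y) (fun u => s x *: df u + ds u *: f x).
Proof.
pose B : {bilinear R -> W -> W} := HB.pack (fun (a : R) (w : W) => a *: w)
  (bilinear_isBilinear.Build R R W W _ _ _ scale_is_bilinear).
by apply: (@is_diff_bilinear _ _ B) => p; exact: scale_continuous.
Qed.

End DifferentialRules.

(** * Calculus in a Euclidean space *)

Section EuclideanCalculus.
Context (R : realType) (H : finNormedModType R) (dot : {dot H for idfun}).
Hypothesis dotE : forall u : H, dot u u = `|u| ^+ 2.

Lemma cauchy_schwarz_unit u e : dot e e = 1 -> `|dot u e| <= `|u|.
Proof.
move=> e1; rewrite -[`|u|]ger0_norm// -ler_sqr ?nnegrE// !real_normK ?num_real//.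
rewrite -dotE -subr_ge0.
have := dot_ge0 dot (u - dot u e *: e).
rewrite dotBl !dotBr !dotZr !dotZl [dot e u]dotC e1.
move=> h; rewrite dotE in h *; nra.
Qed.

Lemma orthonormal_basis_full : exists e : 'I_(\dim {:H}) -> H, orthonormal_family dot e /\
  forall u, u = \sum_i dot u (e i) *: e i.
Proof.
have [e [eo _]] := orthonormal_basis dot {:H}%VS; exists e; split=> // u.
by apply: (orthonormal_expand eo (fun i => memvf (e i)) erefl); exact: memvf.
Qed.

(** In coordinates, |L u| is at most |u| times the sum of the |L e_i|. *)
Lemma findim_linear_continuous (W : normedModType R) (L : {linear H -> W}) :
  continuous L.
Proof.
have [e [eo eE]] := orthonormal_basis_full.
apply: (linear_continuous_of_bound (C := \sum_i `|L (e i)|)) => u.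
rewrite [u in `|L u|]eE linear_sum mulr_suml.
apply: (le_trans (ler_norm_sum _ _ _)); apply: ler_sum => i _.
rewrite linearZ /= normrZ mulrC ler_wpM2l//.
by rewrite cauchy_schwarz_unit// eo eqxx.
Qed.

Section Rules.
Context (V : normedModType R).

Lemma is_diff_findim_linear (W : normedModType R) (L : {linear H -> W})
    (f df : V -> H) x :
  is_diff x f df -> is_diff x (fun y => L (f y)) (fun u => L (df u)).
Proof.
move=> fx; have Lx := is_diff_linear (f x) (@findim_linear_continuous _ L).
exact: (is_diff_comp fx Lx).
Qed.

Lemma dot_is_bilinear : bilinear_for
  (GRing.Scale.Law.clone _ _ *:%R _) (GRing.Scale.Law.clone _ _ *:%R _)
  (fun u v : H => dot u v : R).
Proof.
split=> [w|b] a c d /=; first by rewrite dotDl dotZl.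
by rewrite dotDr dotZr.
Qed.

(** The inner product is a polynomial in the coordinates. *)
Lemma dot_continuous : continuous (fun p : H * H => dot p.1 p.2).
Proof.
have [e [eo eE]] := orthonormal_basis_full.
have -> : (fun p : H * H => dot p.1 p.2) =
          (fun p => \sum_i dot p.1 (e i) * dot p.2 (e i)).
  apply/funext => p; rewrite {1}(eE p.1) dot_suml; apply: eq_bigr => i _.
  by rewrite dotZl [dot (e i) _]dotC.
move=> p; apply: (cvg_big add_continuous) => i _.
pose L := dot_form dot (e i).
have Lc : continuous (L : H -> R) by exact: (@findim_linear_continuous _ L).
apply: cvgM.
  by apply: (@continuous_comp _ _ _ fst (L : H -> R) p); [exact: cvg_fst|exact: Lc].
by apply: (@continuous_comp _ _ _ snd (L : H -> R) p); [exact: cvg_snd|exact: Lc].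
Qed.

Lemma is_diff_dot (f g df dg : V -> H) x : is_diff x f df -> is_diff x g dg ->
  is_diff x (fun y => dot (f y) (g y))
            (fun u => dot (f x) (dg u) + dot (df u) (g x)).
Proof.
pose B : {bilinear H -> H -> R} := HB.pack (fun u v : H => dot u v : R)
  (bilinear_isBilinear.Build R H H R _ _ _ dot_is_bilinear).
by apply: (@is_diff_bilinear _ _ _ _ _ B); exact: dot_continuous.
Qed.

Context (k : nat).

Definition ffun_inj (i : 'I_k) (u : H) : {ffun 'I_k -> H} :=
  [ffun j => if j == i then u else 0].

Fact ffun_inj_is_linear i : linear (ffun_inj i).
Proof.
by move=> a u v; apply/ffunP => j; rewrite !ffunE; case: eqP; rewrite // scaler0 addr0.
Qed.

HB.instance Definition _ i :=
  GRing.isLinear.Build R H {ffun 'I_k -> H} *:%R (ffun_inj i) (ffun_inj_is_linear i).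

Definition ffun_ev (i : 'I_k) (w : {ffun 'I_k -> H}) : H := w i.

Fact ffun_ev_is_linear i : linear (ffun_ev i).
Proof. by move=> a u v; rewrite /ffun_ev !ffunE. Qed.

HB.instance Definition _ i :=
  GRing.isLinear.Build R {ffun 'I_k -> H} H *:%R (ffun_ev i) (ffun_ev_is_linear i).

Lemma ffun_ev_continuous i : continuous (ffun_ev i).
Proof.
apply: (linear_continuous_of_bound (C := 1)) => w; rewrite mul1r /ffun_ev.
rewrite [X in _ <= X](bigD1 i)//= lerDl sumr_ge0//.
Qed.

Lemma is_diff_ffun (f df : 'I_k -> V -> H) x :
  (forall i, is_diff x (f i) (df i)) ->
  is_diff x (fun y => [ffun i => f i y]) (fun u => [ffun i => df i u]).
Proof.
move=> fx.
have gE (g : 'I_k -> V -> H) : (fun y => [ffun i => g i y]) =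
    (fun y => \sum_i ffun_inj i (g i y)).
  apply/funext => y; apply/ffunP => i; rewrite ffunE sum_ffunE (bigD1 i)//=.
  by rewrite ffunE eqxx big1 ?addr0// => j ji; rewrite ffunE eq_sym (negPf ji).
rewrite !gE; apply: is_diff_bigsum => i _.
exact: is_diff_findim_linear.
Qed.

End Rules.
End EuclideanCalculus.

(** * Symmetry of second derivatives *)

Section Schwarz.
Context (R : realType) (V : normedModType R).
Implicit Types (f : V -> R) (p q u v x : V).

Lemma mean_value_line f p q (h : R) : (forall y, differentiable f y) -> 0 < h ->
  exists s, [/\ 0 < s, s < h & f (p + h *: q) - f p = h * 'd f (p + s *: q) q].
Proof.
move=> df h0; pose g (s : R) := f (p + s *: q).
have dg s : is_diff s g (fun t => 'd f (p + s *: q) (t *: q)).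
  have dl : is_diff s (fun t => p + t *: q) (fun t => t *: q).
    have := is_diffD (is_diff_cst p s) (is_diff_scale (is_diff_id s) (is_diff_cst q s)).
    move=> h1; apply: (is_diff_eq h1); apply/funext => t.
    by rewrite !fctE scaler0 !add0r.
  have dfs : is_diff (p + s *: q) f ('d f (p + s *: q)) by exact: differentiableP.
  exact: (is_diff_comp dl dfs).
have dv (s : R) : is_derive s 1 g ('d f (p + s *: q) q).
  apply: DeriveDef; first by apply: diff_derivable; exact: ex_diff.
  by rewrite deriveE ?diff_val ?scale1r//; exact: ex_diff.
have [|s] := MVT h0 (fun s _ => dv s).
  apply: continuous_subspaceT => s.
  exact: (differentiable_continuous (ex_diff (is_diff_def := dg s))).
rewrite in_itv /= => /andP[s0 sh]; rewrite /g scale0r addr0 subr0 mulrC => gE.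
by exists s.
Qed.

(** The mean value theorem is applied to y |-> f (y + h v) - f y along u, then
    to the derivative of f in the direction u along v. *)
Lemma second_difference f x u v (h : R) : Cn 2 f -> 0 < h ->
  exists s t, [/\ 0 < s < h, 0 < t < h &
    f (x + h *: u + h *: v) - f (x + h *: u) - f (x + h *: v) + f x =
    h * (h * 'd (fun y => 'd f y u) (x + s *: u + t *: v) v)].
Proof.
move=> [df ddf] h0; pose F y := f (y + h *: v) - f y.
have dF y : is_diff y F (fun w => 'd f (y + h *: v) w - 'd f y w).
  have ds : is_diff y (fun y => y + h *: v) id.
    by apply: (is_diff_eq (is_diffD (is_diff_id y) (is_diff_cst (h *: v) y))); rewrite addr0.
  have d1 : is_diff y (f \o (fun y => y + h *: v)) ('d f (y + h *: v) \o id).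
    by apply: is_diff_comp; exact: differentiableP.
  exact: (is_diffB d1 (differentiableP (df y))).
have [|s [s0 sh Fs]] := @mean_value_line F x u h _ h0.
  by move=> y; exact: ex_diff.
have [|t [t0 th ft]] := @mean_value_line (fun y => 'd f y u) (x + s *: u) v h _ h0.
  by have [] := ddf u.
exists s, t; rewrite s0 t0; split=> //.
rewrite -ft -[in LHS]addrA [- f _ + _]addrC [f x - _]addrC -[LHS]opprK.
move: Fs; rewrite diff_val /F => Fs; rewrite opprK -Fs.
by rewrite opprB [x + h *: v]addrC; ring.
Qed.

(** The second difference is symmetric in u and v, so the two mixed derivatives
    agree at points arbitrarily close to x, and they are continuous. *)
Lemma schwarz f x u v : Cn 2 f ->
  'd (fun y => 'd f y u) x v = 'd (fun y => 'd f y v) x u.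
Proof.
move=> f2; apply/eqP/negPn/negP => ne.
pose G a b y : R := 'd (fun y => 'd f y a) y b.
have Gc a b : continuous (G a b).
  by have [_ /(_ a)[_ /(_ b)]] := f2.
pose e := `|G u v x - G v u x| / 2.
have e0 : 0 < e by rewrite divr_gt0// normr_gt0 subr_eq0.
have near a b : exists2 d, 0 < d & forall y, `|x - y| < d -> `|G a b x - G a b y| < e.
  have /cvgrPdist_lt/(_ e e0) := Gc a b x.
  move=> /nbhs_ballP[d /= d0 dG]; exists d => // y xy.
  by apply: dG; rewrite -ball_normE.
have [d1 d10 P1] := near u v; have [d2 d20 P2] := near v u.
pose d := Num.min d1 d2.
have d0 : 0 < d by rewrite lt_min d10.
(* Small enough for every x + s u + t v with s, t < h to be d-close to x. *)
pose h := d / (`|u| + `|v| + 1).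
have uv0 : 0 < `|u| + `|v| + 1 by rewrite ltr_wpDl// addr_ge0.
have h0 : 0 < h by rewrite divr_gt0.
have close a b s t : (`|a| + `|b| = `|u| + `|v|) -> 0 < s < h -> 0 < t < h ->
    `|x - (x + s *: a + t *: b)| < d.
  move=> ab /andP[s0 sh] /andP[t0 th]; rewrite -addrA opprD addNKr normrN.
  apply: (le_lt_trans (ler_normD _ _)); rewrite !normrZ !gtr0_norm//.
  apply: (@le_lt_trans _ _ (h * (`|u| + `|v|))).
    by rewrite -ab mulrDr lerD// ler_wpM2r// ltW.
  by rewrite /h -mulrA gtr_pMr// mulrC ltr_pdivrMr// mul1r ltrDl.
have [s [t [sh th E1]]] := second_difference x u v f2 h0.
have [t' [s' [th' sh' E2]]] := second_difference x v u f2 h0.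
have GG : G u v (x + s *: u + t *: v) = G v u (x + t' *: v + s' *: u).
  apply: (mulfI (lt0r_neq0 h0)); apply: (mulfI (lt0r_neq0 h0)).
  rewrite -[LHS]E1 -[RHS]E2 [x + h *: v + _]addrAC; ring.
have c1 : `|G u v x - G u v (x + s *: u + t *: v)| < e.
  apply: P1; apply: (lt_le_trans (close _ _ _ _ erefl sh th)).
  by rewrite ge_min lexx.
have c2 : `|G v u x - G v u (x + t' *: v + s' *: u)| < e.
  apply: P2.
  apply: (lt_le_trans (close _ _ _ _ (addrC _ _) th' sh')).
  by rewrite ge_min lexx orbT.
have : `|G u v x - G v u x| < e + e.
  rewrite -(subrKA (G u v (x + s *: u + t *: v))) [X in _ + (X - _)]GG.
  by rewrite (le_lt_trans (ler_normD _ _))// ltrD// distrC.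
by rewrite /e -splitr ltxx.
Qed.

End Schwarz.

Lemma CnS (R : realType) (V : normedModType R) n (f : V -> R) : Cn n.+1 f -> Cn n f.
Proof.
elim: n f => [|n IHn] f [df ddf]; first by move=> x; exact: differentiable_continuous.
by split=> // v; exact/IHn/ddf.
Qed.

(** * Determinants and inverse matrices *)

Section MatrixRules.
Context (R : realType) (V : normedModType R).

Lemma differentiable_mul (f g : V -> R) x : differentiable f x ->
  differentiable g x -> differentiable (fun y => f y * g y) x.
Proof. exact: differentiableM. Qed.

Lemma differentiable_prod (I : Type) (r : seq I) (P : pred I) (f : I -> V -> R) x :
  (forall i, differentiable (f i) x) ->
  differentiable (fun y => \prod_(i <- r | P i) f i y) x.
Proof.
move=> df; elim: r => [|i r IHr].
  have -> : (fun y => \prod_(i <- [::] | P i) f i y) = cst 1.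
    by apply/funext => y; rewrite big_nil.
  exact: differentiable_cst.
have -> : (fun y => \prod_(j <- i :: r | P j) f j y) =
    if P i then f i * (fun y => \prod_(j <- r | P j) f j y)
    else fun y => \prod_(j <- r | P j) f j y.
  by apply/funext => y; rewrite big_cons; case: ifP.
by case: ifP => // _; exact: differentiableM.
Qed.

Lemma differentiable_det n (G : V -> 'M[R]_n) x :
  (forall i j, differentiable (fun y => G y i j) x) ->
  differentiable (fun y => \det (G y)) x.
Proof.
move=> dG; rewrite /determinant; apply: differentiable_bigsum => s _.
apply: differentiable_mul; first exact: differentiable_cst.
by apply: differentiable_prod => i; exact: dG.
Qed.

(** Near x the inverse is given by the cofactor formula, as det (G x) != 0. *)
Lemma differentiable_invmx n (G : V -> 'M[R]_n) x :
  (forall i j, differentiable (fun y => G y i j) x) -> G x \in unitmx ->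
  forall i j, differentiable (fun y => invmx (G y) i j) x.
Proof.
move=> dG; rewrite unitmxE unitfE => Gx i j.
have ddet := differentiable_det dG.
have det_near : \forall y \near x, \det (G y) != 0.
  exact: (cvgr_neq0 (\det (G x)) (differentiable_continuous ddet)).
have dinv : differentiable (fun y => (\det (G y))^-1 * (\adj (G y)) i j) x.
  apply: (differentiable_mul (differentiableV ddet Gx)).
  have -> : (fun y => (\adj (G y)) i j) =
     (fun y => (-1) ^+ (j + i) * \det (row' j (col' i (G y)))).
    by apply/funext => y; rewrite mxE.
  apply: differentiable_mul; first exact: differentiable_cst.
  apply: differentiable_det => a b.
  rewrite (_ : (fun y => _) = (fun y => G y (lift j a) (lift i b))); first exact: dG.
  by apply/funext => y; rewrite !mxE.
suff /is_diff_near_eq/(_ (differentiableP dinv))[] : \forall y \near x,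
  (\det (G y))^-1 * (\adj (G y)) i j = invmx (G y) i j by [].
apply: filterS det_near => y Gy.
by rewrite /invmx unitmxE unitfE Gy [RHS]mxE.
Qed.

End MatrixRules.

(** * Gradient and Hessian *)

Section Gradient.
Context (R : realType) (H : finNormedModType R) (dot : {dot H for idfun}).
Hypothesis dotE : forall u : H, dot u u = `|u| ^+ 2.
Implicit Types (f : H -> R) (x y u v xi eta : H).

(** Riesz representation: the vector with coordinates 'd f y (e i). *)
Lemma dot_gradient f y u : dot (gradient dot f y) u = 'd f y u.
Proof.
have [e [eo eE]] := orthonormal_basis_full dot.
have : exists g, forall v, 'd f y v = dot g v.
  exists (\sum_i 'd f y (e i) *: e i) => v.
  rewrite [v in LHS]eE linear_sum dot_suml; apply: eq_bigr => i _.
  by rewrite linearZ dotZl /= [dot (e i) v]dotC mulrC.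
by move=> /(xgetPex 0) ->.
Qed.

Lemma differentiable_gradient f x : Cn 2 f -> differentiable (gradient dot f) x.
Proof.
move=> [_ ddf]; have [e [eo eE]] := orthonormal_basis_full dot.
have -> : gradient dot f = (fun y => \sum_i 'd f y (e i) *: e i).
  apply/funext => y; rewrite [LHS]eE; apply: eq_bigr => i _.
  by rewrite dot_gradient.
apply: differentiable_bigsum => i _; apply: differentiableZl.
by have [] := ddf (e i).
Qed.

(** 'd f y u = <gradient f y, u>, differentiated in y. *)
Lemma dot_hessian f x xi u : Cn 2 f ->
  dot (hessian dot f x xi) u = 'd (fun y => 'd f y u) x xi.
Proof.
move=> f2.
have h := is_diff_dot dotE (differentiableP (differentiable_gradient x f2))
  (is_diff_cst u x).
have -> : (fun y => 'd f y u) = (fun y => dot (gradient dot f y) (cst u y)).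
  by apply/funext => y; rewrite dot_gradient.
by rewrite diff_val /= dot0r add0r.
Qed.

Lemma hessian_sym f x u v : Cn 2 f ->
  dot (hessian dot f x u) v = dot u (hessian dot f x v).
Proof.
by move=> f2; rewrite [RHS]dotC !dot_hessian// schwarz.
Qed.

(** The entries of the Hessian in an orthonormal basis are C^1, and hessian is
    linear in its last argument. *)
Lemma differentiable_hessian (V : normedModType R) f (p eta : V -> H) (z : V) :
  Cn 3 f -> differentiable p z -> differentiable eta z ->
  differentiable (fun t => hessian dot f (p t) (eta t)) z.
Proof.
move=> f3 dp deta; have f2 := CnS f3; have [e [eo eE]] := orthonormal_basis_full dot.
have -> : (fun t => hessian dot f (p t) (eta t)) = (fun t =>
    \sum_i (\sum_j dot (eta t) (e j) * 'd (fun w => 'd f w (e i)) (p t) (e j)) *: e i).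
  apply/funext => t; rewrite [LHS]eE; apply: eq_bigr => i _; congr (_ *: _).
  rewrite dot_hessian// [eta t in LHS]eE linear_sum; apply: eq_bigr => j _.
  by rewrite linearZ.
apply: differentiable_bigsum => i _; apply: differentiableZl.
apply: differentiable_bigsum => j _.
have d1 := ex_diff (is_diff_def :=
  is_diff_dot dotE (differentiableP deta) (is_diff_cst (e j) z)).
apply: differentiable_mul => //.
apply: (@differentiable_comp _ _ _ _ p (fun y => 'd (fun w => 'd f w (e i)) y (e j))) => //.
by have [_ /(_ (e i)) [_ /(_ (e j)) []]] := f3.
Qed.

End Gradient.

(** * Tangent space and Riemannian Hessian *)

Section TangentSpace.
Context (R : realType) (H : finNormedModType R) (dot : {dot H for idfun}).
Context (m : nat) (A : 'I_m -> H).

Lemma dot_tappl (B : 'I_m -> H) t u : dot (tapp B t) u = \sum_i t i 0 * dot (B i) u.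
Proof. by rewrite dot_suml; apply: eq_bigr => i _; rewrite dotZl. Qed.

Lemma ttr_tapp t : ttr dot A (tapp A t) = tgram dot A A *m t.
Proof.
apply/colP => i; rewrite !mxE dot_tappl; apply: eq_bigr => j _.
by rewrite mxE mulrC.
Qed.

(** u G = 0 gives |A u^T|^2 = 0. *)
Lemma gram_unit : free [seq A l | l <- enum 'I_m] -> tgram dot A A \in unitmx.
Proof.
have tP : size [seq A l | l <- enum 'I_m] == m by rewrite size_map size_enum_ord.
move=> /(@freeP _ _ _ (Tuple tP)) Afree.
rewrite -row_free_unit; apply: inj_row_free => u uG.
have ut0 : tapp A u^T = 0.
  apply/eqP; rewrite -(dot_eq0 dot) dot_tappl big1// => i _.
  suff -> : dot (A i) (tapp A u^T) = 0 by rewrite mulr0.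
  have := congr1 (fun M : 'rV_m => M 0 i) uG; rewrite !mxE => <-.
  rewrite dot_sumr; apply: eq_bigr => j _.
  by rewrite dotZr !mxE.
apply/rowP => i; rewrite mxE; have := Afree (fun i => u 0 i) _ i; apply.
rewrite -[RHS]ut0; apply: eq_bigr => j _.
by rewrite mxE /= (nth_map j) ?size_enum_ord// nth_ord_enum.
Qed.

End TangentSpace.

Section Geometry.
Context (R : realType) (H : finNormedModType R) (dot : {dot H for idfun}).
Context (m : nat) (c : 'I_m -> H -> R) (x : H).
Local Notation A := (Amx dot c x).
Local Notation G := (tgram dot A A).
Local Notation T := (tangent dot c x).

Lemma tangentP u : u \in T <-> forall l, dot u (A l) = 0.
Proof.
rewrite mem_tangent; split=> [/eqP/colP u0 l|u0]; first by have := u0 l; rewrite !mxE.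
by apply/eqP/colP => l; rewrite !mxE.
Qed.

Fact proj_tangent_is_linear : linear (proj_tangent dot c x).
Proof.
move=> a u w; rewrite /proj_tangent /multiplier linearP mulmxDr -scalemxAr.
have tD s t : tapp A (a *: s + t) = a *: tapp A s + tapp A t.
  rewrite /tapp scaler_sumr -big_split; apply: eq_bigr => l _.
  by rewrite !mxE scalerDl scalerA.
by rewrite tD scalerBr opprD addrACA.
Qed.

HB.instance Definition _ := GRing.isLinear.Build R H H *:%R
  (proj_tangent dot c x) proj_tangent_is_linear.

Fact hessian_is_linear f y : linear (hessian dot f y).
Proof. by move=> a u w; exact: linearP. Qed.

Fact rhess_is_linear (E : H -> R) : linear (rhess dot c E x).
Proof.
move=> a u w; rewrite /rhess -linearP; congr proj_tangent.
have -> t : tapp (hess_c dot c x (a *: u + w)) t =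
    a *: tapp (hess_c dot c x u) t + tapp (hess_c dot c x w) t.
  rewrite /tapp scaler_sumr -big_split; apply: eq_bigr => l _.
  by rewrite /hess_c hessian_is_linear scalerDr !scalerA mulrC.
by rewrite hessian_is_linear scalerBr opprD addrACA.
Qed.

HB.instance Definition _ (E : H -> R) := GRing.isLinear.Build R H H *:%R
  (rhess dot c E x) (rhess_is_linear E).

Fact rhess_ext_is_linear (E : H -> R) : linear (rhess_ext dot c E x).
Proof. by move=> a u w; rewrite /rhess_ext linearP [LHS]linearP. Qed.

HB.instance Definition _ (E : H -> R) := GRing.isLinear.Build R H H *:%R
  (rhess_ext dot c E x) (rhess_ext_is_linear E).

Hypothesis G_unit : G \in unitmx.

Lemma proj_tangent_mem u : proj_tangent dot c x u \in T.
Proof.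
rewrite mem_tangent /proj_tangent linearB /= ttr_tapp mulmxA mulmxV// mul1mx.
by rewrite subrr.
Qed.

Lemma proj_tangent_id u : u \in T -> proj_tangent dot c x u = u.
Proof.
rewrite mem_tangent => /eqP u0; rewrite /proj_tangent /multiplier u0 mulmx0.
by rewrite /tapp big1 ?subr0// => l _; rewrite mxE scale0r.
Qed.

Lemma proj_tangent_normal t : proj_tangent dot c x (tapp A t) = 0.
Proof.
by rewrite /proj_tangent /multiplier ttr_tapp mulmxA mulVmx// mul1mx subrr.
Qed.

Lemma dot_proj_tangent u w : w \in T ->
  dot (proj_tangent dot c x u) w = dot u w.
Proof.
move=> /tangentP wA; rewrite dotBl dot_tappl big1 ?subr0// => l _.
by rewrite dotC wA mulr0.
Qed.

(** A^T is surjective onto R^m, since A^T A is invertible. *)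
Lemma dim_tangent : (\dim T = \dim {:H} - m)%N.
Proof.
have := limg_ker_dim (linfun (ttr dot A)) {:H}; rewrite capfv -/T => <-.
suff -> : (linfun (ttr dot A) @: {:H})%VS = {:'cV_m}%VS.
  by rewrite dimvf /= /dim /= muln1 addnK.
apply/eqP; rewrite eqEsubv subvf /=; apply/subvP => t _.
apply/memv_imgP; exists (tapp A (invmx G *m t)); first exact: memvf.
by rewrite lfunE /= ttr_tapp mulmxA mulmxV// mul1mx.
Qed.

Hypothesis dotE : forall u : H, dot u u = `|u| ^+ 2.
Hypothesis c2 : forall l, Cn 2 (c l).
Context (E : H -> R) (E2 : Cn 2 E).

Lemma rhess_mem u : rhess dot c E x u \in T.
Proof. exact: proj_tangent_mem. Qed.

Lemma rhess_ext_mem u : rhess_ext dot c E x u \in T.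
Proof. exact: proj_tangent_mem. Qed.

Lemma rhess_ext_tangent : {in T, rhess_ext dot c E x =1 rhess dot c E x}.
Proof. by move=> u uT; rewrite /rhess_ext proj_tangent_id. Qed.

(** On tangent vectors the projection can be dropped, and what remains is a
    linear combination of Hessians. *)
Lemma rhess_sym : {in T &, forall u w,
  dot (rhess dot c E x u) w = dot u (rhess dot c E x w)}.
Proof.
move=> u w uT wT; rewrite dot_proj_tangent// [RHS]dotC dot_proj_tangent//.
rewrite !dotBl (hessian_sym dotE x u w E2) [dot u _]dotC !dot_tappl; congr (_ - _).
apply: eq_bigr => l _; congr (_ * _); rewrite [RHS]dotC.
exact: (hessian_sym dotE x u w (c2 l)).
Qed.

Lemma dot_rhess_ext p u : p \in T ->
  dot p (rhess_ext dot c E x u) = dot (rhess dot c E x p) u.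
Proof.
move=> pT; rewrite -rhess_sym// ?proj_tangent_mem// [LHS]dotC [RHS]dotC.
by rewrite dot_proj_tangent ?rhess_mem.
Qed.

End Geometry.

(** * Differentiability of the right-hand side *)

Section Dynamics.
Context (R : realType) (H : finNormedModType R) (dot : {dot H for idfun}).
Hypothesis dotE : forall u : H, dot u u = `|u| ^+ 2.
Context (m : nat) (c : 'I_m -> H -> R) (c3 : forall l, Cn 3 (c l)).
Context (E : H -> R) (E3 : Cn 3 E) (x : H).
Local Notation A := (Amx dot c).
Local Notation G y := (tgram dot (A y) (A y)).
Hypothesis G_unit : G x \in unitmx.

Let c2 l : Cn 2 (c l) := CnS (c3 l).
Let E2 : Cn 2 E := CnS E3.

(* The ingredients of the right-hand side, along maps p, eta from a parameter
   space V; p z = x makes the Gram matrix invertible near z. *)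
Section Pieces.
Context (V : normedModType R) (p eta : V -> H) (z : V).
Hypotheses (dp : differentiable p z) (pz : p z = x) (deta : differentiable eta z).

Lemma differentiable_dot (f g : V -> H) : differentiable f z -> differentiable g z ->
  differentiable (fun t => dot (f t) (g t)) z.
Proof.
move=> df dg.
exact: (ex_diff (is_diff_def := is_diff_dot dotE (differentiableP df) (differentiableP dg))).
Qed.

Lemma differentiable_scale (f : V -> R) (g : V -> H) : differentiable f z ->
  differentiable g z -> differentiable (fun t => f t *: g t) z.
Proof.
move=> df dg.
exact: (ex_diff (is_diff_def := is_diff_scale (differentiableP df) (differentiableP dg))).
Qed.

Lemma differentiable_gradient_comp f : Cn 2 f ->
  differentiable (fun t => gradient dot f (p t)) z.
Proof.
by move=> f2; apply: differentiable_comp => //; exact: differentiable_gradient.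
Qed.

Lemma differentiable_invgram i j :
  differentiable (fun t => invmx (G (p t)) i j) z.
Proof.
apply: differentiable_invmx; last by rewrite pz.
move=> a b.
have -> : (fun t => (G (p t)) a b) =
  (fun t => dot (gradient dot (c b) (p t)) (gradient dot (c a) (p t))).
  by apply/funext => t; rewrite mxE.
apply: differentiable_dot; first exact: (differentiable_gradient_comp (c2 b)).
exact: (differentiable_gradient_comp (c2 a)).
Qed.

Lemma differentiable_tapp (B : V -> 'I_m -> H) (s : V -> 'cV[R]_m) :
  (forall l, differentiable (fun t => B t l) z) ->
  (forall l, differentiable (fun t => s t l 0) z) ->
  differentiable (fun t => tapp (B t) (s t)) z.
Proof.
by move=> dB ds; apply: differentiable_bigsum => l _; exact: differentiable_scale.
Qed.

Lemma differentiable_invgram_mul (s : V -> 'cV[R]_m) l :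
  (forall j, differentiable (fun t => s t j 0) z) ->
  differentiable (fun t => (invmx (G (p t)) *m s t) l 0) z.
Proof.
move=> ds.
have -> : (fun t => (invmx (G (p t)) *m s t) l 0) =
          (fun t => \sum_j invmx (G (p t)) l j * s t j 0).
  by apply/funext => t; rewrite mxE.
apply: differentiable_bigsum => j _; apply: differentiable_mul => //.
exact: differentiable_invgram.
Qed.

Lemma differentiable_ttr (B : V -> 'I_m -> H) l :
  (forall j, differentiable (fun t => B t j) z) ->
  differentiable (fun t => ttr dot (B t) (eta t) l 0) z.
Proof.
move=> dB.
have -> : (fun t => ttr dot (B t) (eta t) l 0) = (fun t => dot (eta t) (B t l)).
  by apply/funext => t; rewrite mxE.
exact: differentiable_dot.
Qed.

Lemma differentiable_multiplier l :
  differentiable (fun t => multiplier dot c (p t) (eta t) l 0) z.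
Proof.
apply: differentiable_invgram_mul => j; apply: differentiable_ttr => i.
exact: (differentiable_gradient_comp (c2 i)).
Qed.

Lemma differentiable_proj_tangent :
  differentiable (fun t => proj_tangent dot c (p t) (eta t)) z.
Proof.
apply: differentiableB => //; apply: differentiable_tapp => l.
  exact: (differentiable_gradient_comp (c2 l)).
exact: differentiable_multiplier.
Qed.

End Pieces.

Lemma differentiable_rhess (V : normedModType R) (p eta : V -> H) (z : V) :
  differentiable p z -> p z = x -> differentiable eta z ->
  differentiable (fun t => rhess dot c E (p t) (eta t)) z.
Proof.
move=> dp pz deta; apply: differentiable_proj_tangent => //.
apply: differentiableB; first exact: (differentiable_hessian dotE E3 dp deta).
apply: differentiable_tapp => l; first exact: (differentiable_hessian dotE (c3 l) dp deta).
apply: (differentiable_multiplier dp pz).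
exact: (differentiable_gradient_comp dp E2).
Qed.

Lemma differentiable_rhess_ext (V : normedModType R) (p eta : V -> H) (z : V) :
  differentiable p z -> p z = x -> differentiable eta z ->
  differentiable (fun t => rhess_ext dot c E (p t) (eta t)) z.
Proof.
move=> dp pz deta; apply: differentiable_rhess => //.
exact: differentiable_proj_tangent.
Qed.

Lemma differentiable_rgrad : differentiable (rgrad dot c E) x.
Proof.
apply: (@differentiable_proj_tangent _ id (gradient dot E)) => //.
exact: (@differentiable_gradient _ _ dot _ x E2).
Qed.

Lemma near_gram_unit : \forall y \near x, G y \in unitmx.
Proof.
have dG i j : differentiable (fun y => (G y) i j) x.
  have -> : (fun y => (G y) i j) =
     (fun y => dot (gradient dot (c j) y) (gradient dot (c i) y)).
    by apply/funext => y; rewrite mxE.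
  apply: differentiable_dot; first exact: (@differentiable_gradient _ _ dot _ x (c2 j)).
  exact: (@differentiable_gradient _ _ dot _ x (c2 i)).
have Gx : \det (G x) != 0 by rewrite -unitfE -unitmxE.
have det_near : \forall y \near x, \det (G y) != 0.
  exact: (cvgr_neq0 (\det (G x)) (differentiable_continuous (differentiable_det dG)) Gx).
by apply: filterS det_near => y; rewrite unitmxE unitfE.
Qed.

(** Let D be the derivative of grad E at x in the direction u.  Differentiating
    <grad E(y), grad c_l(y)> = 0 and using grad E(x) = 0 shows that D is
    tangent.  Differentiating grad E = nabla E - A M, with M the vector of
    multipliers, gives D = nabla^2 E u - (nabla^2 c u) M - A M', and the
    projection, which fixes D and kills A M', turns this into D = S u. *)
Lemma is_diff_rgrad : rgrad dot c E x = 0 ->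
  is_diff x (rgrad dot c E) (rhess dot c E x).
Proof.
move=> g0; have dg := differentiable_rgrad.
suff DE u : 'd (rgrad dot c E) x u = rhess dot c E x u.
  by apply: DiffDef => //; apply/funext.
set D := 'd _ x u.
have DT : D \in tangent dot c x.
  apply/tangentP => l.
  have d1 := is_diff_dot dotE (differentiableP dg)
    (differentiableP (@differentiable_gradient _ _ dot _ x (c2 l))).
  have : \forall y \near x, dot (rgrad dot c E y) (gradient dot (c l) y) = 0.
    apply: filterS near_gram_unit => y Gy.
    by have /tangentP -> := proj_tangent_mem Gy (gradient dot E y).
  move=> /is_diff_near0/(@diff_val _ _ _ _ _ _ _); rewrite diff_val.
  by move=> /(congr1 (fun f => f u)) /=; rewrite g0 dot0l add0r.
pose M y := multiplier dot c y (gradient dot E y).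
have dM l : differentiable (fun y => M y l 0) x.
  apply: (@differentiable_multiplier _ id) => //.
  exact: (@differentiable_gradient _ _ dot _ x E2).
have dgE := differentiableP (@differentiable_gradient _ _ dot _ x E2).
have dterm l := is_diff_scale (differentiableP (dM l))
  (differentiableP (@differentiable_gradient _ _ dot _ x (c2 l))).
have dsum := is_diff_bigsum (index_enum 'I_m) (P := xpredT) (fun l _ => dterm l).
have := is_diffB dgE dsum.
move=> /(@diff_val _ _ _ _ _ _ _) DE; have {DE} : D = hessian dot E x u -
  \sum_l (M x l 0 *: hessian dot (c l) x u + 'd (fun y => M y l 0) x u *: A x l).
  exact: (congr1 (fun f => f u) DE).
rewrite big_split /= opprD addrA => DE.
rewrite -(proj_tangent_id DT) DE linearB /=.
have -> : \sum_l 'd (fun y => M y l 0) x u *: A x l =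
    tapp (A x) (\col_l 'd (fun y => M y l 0) x u).
  by apply: eq_bigr => l _; rewrite mxE.
by rewrite proj_tangent_normal// subr0.
Qed.

End Dynamics.

(** * Jacobian of the dynamics *)

(** The last term of the v-equation is linear in the velocity of x. *)
Lemma rhs_v_at_rest (R : realType) (H : finNormedModType R) (dot : {dot H for idfun})
    (m k : nat) (c : 'I_m -> H -> R) (E : H -> R) (mu : R) (x : H)
    (w : 'I_k -> H) (i : 'I_k) :
  rhs_x dot c E mu x w = 0 ->
  rhs_v dot c E mu x w i =
  - (rhess_ext dot c E x (w i) - outer dot (w i) (rhess_ext dot c E x (w i))
     - \sum_(j < k | (j < i)%N) 2 *: outer dot (w j) (rhess_ext dot c E x (w i))).
Proof.
move=> x0; rewrite /rhs_v x0.
have -> : ttr dot (hess_c dot c x 0) (w i) = 0.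
  apply/colP => l; rewrite !mxE /hess_c.
  have -> : hessian dot (c l) x 0 = 0 by exact: linear0.
  by rewrite dot0r.
by rewrite mulmx0 /tapp [X in _ - X]big1 ?subr0// => l _; rewrite mxE scale0r.
Qed.

Section Jacobian.
Context (R : realType) (H : finNormedModType R) (dot : {dot H for idfun}).
Hypothesis dotE : forall u : H, dot u u = `|u| ^+ 2.
Context (m k : nat) (c : 'I_m -> H -> R) (c3 : forall l, Cn 3 (c l)).
Context (E : H -> R) (E3 : Cn 3 E) (mu : R) (x : H) (v : {ffun 'I_k -> H}).
Local Notation A := (Amx dot c).
Local Notation S := (rhess dot c E x).
Local Notation Q := (rhess_ext dot c E x).
Hypothesis G_unit : tgram dot (A x) (A x) \in unitmx.
Hypothesis x_on : on_manifold c x.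
Hypothesis g0 : rgrad dot c E x = 0.
Local Notation Z := (H * {ffun 'I_k -> H})%type.

Let c2 l : Cn 2 (c l) := CnS (c3 l).
Let E2 : Cn 2 E := CnS E3.

Lemma fst_is_diff (z : Z) : is_diff z (fst : Z -> H) (fst : Z -> H).
Proof.
apply: (@is_diff_linear _ _ _ fst) => y; exact: cvg_fst.
Qed.

Lemma coord_is_diff (z : Z) i : is_diff z (fun y : Z => y.2 i) (fun y : Z => y.2 i).
Proof.
have d1 : is_diff z (snd : Z -> {ffun 'I_k -> H}) snd.
  by apply: (@is_diff_linear _ _ _ snd) => y; exact: cvg_snd.
have d2 := is_diff_linear z.2 (@ffun_ev_continuous _ H _ i).
exact: (is_diff_comp d1 d2).
Qed.

(** As c_l(x) = 0 and grad E(x) = 0, only the terms in which these factors are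
    differentiated survive; in particular the v_i do not contribute. *)
Lemma is_diff_rhs_x : is_diff (x, v) (fun z : Z => rhs_x dot c E mu z.1 z.2)
  (fun z => - (S z.1 - \sum_i 2 *: outer dot (v i) (S z.1))
            - mu *: \sum_l dot z.1 (A x l) *: A x l).
Proof.
have dg : is_diff (x, v) (fun z : Z => rgrad dot c E z.1) (fun z => S z.1).
  exact: (is_diff_comp (fst_is_diff (x, v)) (is_diff_rgrad dotE c3 E3 G_unit g0)).
have dvv i : is_diff (x, v) (fun z : Z => 2 *: outer dot (z.2 i) (rgrad dot c E z.1))
    (fun z => 2 *: outer dot (v i) (S z.1)).
  have d1 := is_diff_scale (is_diff_dot dotE (coord_is_diff (x, v) i) dg)
     (coord_is_diff (x, v) i).
  have d2 := is_diff_scale (is_diff_cst (2 : R) (x, v)) d1.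
  apply: (is_diff_eq d2); apply/funext => z /=.
  by rewrite g0 !dot0r !scale0r !add0r addr0 addr0.
have dcl l : is_diff (x, v) (fun z : Z => c l z.1 *: gradient dot (c l) z.1)
    (fun z => dot z.1 (A x l) *: A x l).
  have [dc _] := c2 l.
  have d1 := is_diff_comp (fst_is_diff (x, v)) (differentiableP (dc x)).
  have d2 := is_diff_comp (fst_is_diff (x, v)) 
    (differentiableP (@differentiable_gradient _ _ dot _ x (c2 l))).
  apply: (is_diff_eq (is_diff_scale d1 d2)); apply/funext => z /=.
  by rewrite x_on scale0r add0r -(dot_gradient dot) dotC.
have dsum1 := is_diff_bigsum (index_enum 'I_k) (P := xpredT) (fun i _ => dvv i).
have dsum2 := is_diff_bigsum (index_enum 'I_m) (P := xpredT) (fun l _ => dcl l).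
exact: (is_diffB (is_diffN (is_diffB dg dsum1)) (is_diffZ mu dsum2)).
Qed.

Lemma differentiable_outer (f g : Z -> H) z : differentiable f z ->
  differentiable g z -> differentiable (fun y => outer dot (f y) (g y)) z.
Proof.
by move=> df dg; apply: differentiable_scale => //; apply: differentiable_dot.
Qed.

Lemma differentiable_rhs_v i :
  differentiable (fun z : Z => rhs_v dot c E mu z.1 z.2 i) (x, v).
Proof.
have dx := ex_diff (is_diff_def := fst_is_diff (x, v)).
have dv j := ex_diff (is_diff_def := coord_is_diff (x, v) j).
have dh := differentiable_rhess_ext dotE c3 E3 G_unit dx erefl (dv i).
have drhs := ex_diff (is_diff_def := is_diff_rhs_x).
apply: differentiableB.
  apply: differentiableN; apply: differentiableB.
    by apply: differentiableB => //; apply: differentiable_outer.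
  apply: differentiable_bigsum => j _; apply: differentiableZ.
  exact: differentiable_outer.
apply: differentiable_tapp => // l.
  exact: (@differentiable_gradient_comp _ _ dot _ _ _ dx _ (c2 l)).
apply: (differentiable_invgram_mul dotE c3 G_unit dx erefl) => j.
apply: (differentiable_ttr dotE (dv i)) => a.
exact: (differentiable_hessian dotE (c3 a) dx drhs).
Qed.

Lemma is_diff_dynamics : is_diff (x, v) (saddle_dynamics dot c E mu)
  (fun z : Z => (- (S z.1 - \sum_i 2 *: outer dot (v i) (S z.1))
      - mu *: \sum_l dot z.1 (A x l) *: A x l,
    [ffun i => 'd (fun z : Z => rhs_v dot c E mu z.1 z.2 i) (x, v) z])).
Proof.
have dv i := differentiableP (differentiable_rhs_v i).
exact: (is_diff_pair is_diff_rhs_x (is_diff_ffun dotE dv)).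
Qed.

Lemma rhs_x_critical (w : 'I_k -> H) : rhs_x dot c E mu x w = 0.
Proof.
rewrite /rhs_x g0 big1 => [|i _]; last by rewrite /outer dot0r scale0r scaler0.
rewrite subr0 oppr0 big1 ?scaler0 ?subr0// => l _.
by rewrite x_on scale0r.
Qed.

Lemma rhs_v_critical (w : 'I_k -> H) i : rhs_v dot c E mu x w i =
  - (Q (w i) - outer dot (w i) (Q (w i))
     - \sum_(j < k | (j < i)%N) 2 *: outer dot (w j) (Q (w i))).
Proof. exact/rhs_v_at_rest/rhs_x_critical. Qed.

Context (al : 'I_k -> R).
Hypothesis v_mem : forall i, v i \in tangent dot c x.
Hypothesis vo : orthonormal_family dot v.
Hypothesis Sv : forall i, S (v i) = al i *: v i.

(** For fixed x the velocity of x vanishes identically, so the v-equation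
    reduces to an expression that is cubic in the v_i. *)
Lemma is_diff_rhs_v_in_v i :
  is_diff v (fun w : {ffun 'I_k -> H} => rhs_v dot c E mu x w i)
  (fun w => - (Q (w i) - outer dot (v i) (Q (w i))
     - \sum_(j < k | (j < i)%N) 2 *: outer dot (v j) (Q (w i)))
  + (dot (w i) (v i) * al i) *: v i + al i *: w i
  + \sum_(j < k | (j < i)%N) (2 * (dot (w j) (v i) * al i)) *: v j).
Proof.
have Qv : Q (v i) = al i *: v i by rewrite rhess_ext_tangent.
have -> : (fun w : {ffun 'I_k -> H} => rhs_v dot c E mu x w i) = (fun w =>
  - (Q (w i) - outer dot (w i) (Q (w i))
     - \sum_(j < k | (j < i)%N) 2 *: outer dot (w j) (Q (w i)))).
  by apply/funext => w; rewrite rhs_v_critical.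
have dw j := is_diff_linear v (@ffun_ev_continuous _ H _ j).
have dQ : is_diff v (fun w : {ffun 'I_k -> H} => Q (w i)) (fun w => Q (w i)).
  exact: (is_diff_findim_linear dotE (rhess_ext dot c E x) (dw i)).
have douter j : is_diff v (fun w : {ffun 'I_k -> H} => outer dot (w j) (Q (w i)))
   (fun w => dot (v j) (Q (v i)) *: w j +
             (dot (v j) (Q (w i)) + dot (w j) (Q (v i))) *: v j).
  exact: (is_diff_scale (is_diff_dot dotE (dw j) dQ) (dw j)).
have dsum := is_diff_bigsum (index_enum 'I_k) (P := fun j : 'I_k => (j < i)%N)
  (fun j _ => is_diff_scale (is_diff_cst (2 : R) v) (douter j)).
apply: (is_diff_eq (is_diffN (is_diffB (is_diffB dQ (douter i)) dsum))).
apply/funext => w; rewrite !fctE Qv !dotZr vo eqxx mulr1.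
set s := (X in _ = - (_ - X) + _ + _ + _); set t := (X in _ = _ + X).
rewrite [X in - (_ - X) = _](_ : _ = s + t); last first.
  rewrite /s /t -big_split; apply: eq_bigr => j ji /=.
  rewrite scale0r addr0 !dotZr vo ord_ltn_eqF// mulr0 scale0r add0r.
  by rewrite [X in 2 *: X = _]scalerDl scalerDr !scalerA [al i * _]mulrC.
rewrite scalerDl -/(outer dot (v i) (Q (w i))) [al i * dot _ _]mulrC.
move: (Q (w i)) (outer _ _ _) (_ *: w i) (_ *: v i) s t => q o a b s t.
rewrite !opprD !opprK -!addrA; congr (_ + _).
rewrite addrCA; congr (_ + _); rewrite addrCA [RHS]addrCA; congr (_ + _).
exact: addrCA.
Qed.

Lemma jacobian_x xi w : ('d (saddle_dynamics dot c E mu) (x, v) (xi, w)).1 =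
  - (S xi - \sum_i 2 *: outer dot (v i) (S xi))
  - mu *: \sum_l dot xi (A x l) *: A x l.
Proof. by rewrite (@diff_val _ _ _ _ _ _ _ is_diff_dynamics). Qed.

(** The partial derivative in v is the derivative along the embedding
    w |-> (x, w). *)
Lemma jacobian_v w i : ('d (saddle_dynamics dot c E mu) (x, v) (0, w)).2 i =
  - (Q (w i) - outer dot (v i) (Q (w i))
     - \sum_(j < k | (j < i)%N) 2 *: outer dot (v j) (Q (w i)))
  + (dot (w i) (v i) * al i) *: v i + al i *: w i
  + \sum_(j < k | (j < i)%N) (2 * (dot (w j) (v i) * al i)) *: v j.
Proof.
rewrite (@diff_val _ _ _ _ _ _ _ is_diff_dynamics) /= ffunE.
have di : is_diff v (fun w : {ffun 'I_k -> H} => (x, w)) (fun w => (0, w)).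
  exact: (is_diff_pair (is_diff_cst x v) (is_diff_id v)).
have dc := is_diff_comp di (differentiableP (differentiable_rhs_v i)).
have e1 := @diff_val _ _ _ _ _ _ _ dc.
have e2 := @diff_val _ _ _ _ _ _ _ (is_diff_rhs_v_in_v i).
by have := congr1 (fun f => f w) (etrans (esym e1) e2).
Qed.

End Jacobian.

(** * Linearly stable steady states are saddle points *)

Theorem theorem1 (R : realType) (H : finNormedModType R)
  (dot : {dot H for idfun}) (dotE : forall u : H, dot u u = `|u| ^+ 2)
  (d m k : nat) (dimH : \dim {:H} = d)
  (c : 'I_m -> H -> R) (c_smooth : forall l, smooth (c l))
  (c_free : forall x : H, on_manifold c x ->
     free [seq gradient dot (c l) x | l <- enum 'I_m])
  (k_gt0 : (1 <= k)%N) (k_le : (k <= d - m)%N)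
  (E : H -> R) (E_C3 : Cn 3 E)
  (x : H) (x_on : on_manifold c x)
  (v : {ffun 'I_k -> H}) (v_tangent : forall i, v i \in tangent dot c x)
  (v_unit : forall i, `|v i| = 1)
  (mu : R) (mu_gt0 : 0 < mu)
  (hess_inv : invertible_on (tangent dot c x) (rhess dot c E x))
  (lam : 'I_(d - m) -> R)
  (lam_eig : eigenvalues_on (tangent dot c x) (rhess dot c E x) lam)
  (lam_lt : forall i j : 'I_(d - m), (i < j < k)%N -> lam i < lam j)
  (lam_le : forall i j : 'I_(d - m), (i <= j)%N -> lam i <= lam j) :
  (steady_state (saddle_dynamics dot c E mu) (x, v) /\
   linearly_stable (saddle_dynamics dot c E mu) (x, v))
  <->
  (saddle dot c E k x /\
   forall i : 'I_k, rhess dot c E x (v i) = lam (widen_ord k_le i) *: v i).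
Proof.
have G_unit : tgram dot (Amx dot c x) (Amx dot c x) \in unitmx.
  exact: gram_unit (c_free x x_on).
have c3 l : Cn 3 (c l) := c_smooth l 3%N.
have c2 l : Cn 2 (c l) := CnS (c3 l).
have E2 : Cn 2 E := CnS E_C3.
set S := rhess dot c E x; set T := tangent dot c x.
have dimT : \dim T = (d - m)%N by rewrite dim_tangent// dimH.
have S_sym : {in T &, forall u w, dot (S u) w = dot u (S w)}.
  exact: (rhess_sym dotE c2 E2).
have [e [eo eT Se]] := orthonormal_eigenbasis S_sym lam_eig.
have S_inj : {in T, forall u, S u = 0 -> u = 0}.
  move=> u uT Su; have [w [_ wP]] := hess_inv _ (mem0v T).
  rewrite -(wP u (conj uT Su)); apply: wP; split; first exact: mem0v.
  exact: linear0.
have lam0 l : lam l != 0.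
  have : e l != 0 by rewrite -(dot_eq0 dot) eo eqxx oner_eq0.
  apply: contra => /eqP l0; apply/eqP; apply: (S_inj _ (eT l)).
  by rewrite Se l0 scale0r.
have index := index_of_eigenbasis eo eT Se dimT lam0.
have QS : {in T, rhess_ext dot c E x =1 S} by exact: rhess_ext_tangent.
have v1 i : dot (v i) (v i) = 1 by rewrite dotE v_unit expr1n.
have Q_adj p u : p \in T -> dot p (rhess_ext dot c E x u) = dot (S p) u.
  exact: (dot_rhess_ext G_unit dotE c2 E2).
split.
- case=> steady st.
  have rx0 : rhs_x dot c E mu x v = 0 := congr1 fst steady.
  have rv0 i : rhs_v dot c E mu x v i = 0.
    by have /ffunP/(_ i) := congr1 snd steady; rewrite !ffunE.
  (* The velocity of x vanishes, so only the projected Hessian term remains. *)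
  have eqv i : S (v i) - outer dot (v i) (S (v i))
      - \sum_(j < k | (j < i)%N) 2 *: outer dot (v j) (S (v i)) = 0.
    have := rv0 i; rewrite (rhs_v_at_rest i rx0) (QS _ (v_tangent i)).
    by move=> /eqP; rewrite oppr_eq0 => /eqP.
  have [vo Sv] := steady_eigenvectors S_sym v_tangent S_inj v1 eqv.
  have g0 : rgrad dot c E x = 0.
    apply: (reflection_inj vo); move/eqP: rx0; rewrite /rhs_x.
    rewrite [X in _ - mu *: X]big1 => [|l _]; last by rewrite x_on scale0r.
    by rewrite scaler0 subr0 oppr_eq0 => /eqP.
  have Jx := jacobian_x dotE c3 E_C3 mu v G_unit x_on g0.
  have Jv := jacobian_v dotE c3 E_C3 mu G_unit x_on g0 v_tangent vo Sv.
  have al_lt0 := stable_eigenvalue_lt0 QS v_tangent vo Sv Jx Jv st.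
  have al_incr := stable_eigenvalue_incr QS v_tangent vo Sv Jx Jv st.
  have compl u b uT u0 uv Su := @stable_complement_gt0 _ _ _ _ _ _ _ _ _ _ _
    (@tangentP _ _ dot _ c x) Jx u b st uT u0 uv Su.
  have [lamal lampos] := lowest_eigenvalues S_sym v_tangent k_le eo eT dimT Se
    lam_le vo Sv al_lt0 al_incr compl.
  split; last by move=> i; rewrite lamal; exact: Sv.
  split=> //; suff cN : #|[set l | lam l < 0]%SET| = k by move: index; rewrite cN.
  rewrite -[RHS](card_ord_lt k_le); apply: eq_card => l; rewrite !inE.
  case: ltnP => [lk|/lampos lk]; last by rewrite ltNge ltW.
  have := al_lt0 (Ordinal lk).
  by rewrite -lamal (_ : widen_ord _ _ = l)//; exact: ord_inj.
- case=> -[_ g0 idx] Sv.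
  (* Both numbers are the maximal dimension of a negative definite subspace. *)
  have cN : #|[set l | lam l < 0]%SET| = k.
    have [[U [UT Uneg dU]] Umax] := idx; have [[U' [UT' Uneg' dU']] Umax'] := index.
    apply/eqP; rewrite eqn_leq; apply/andP; split.
      by rewrite -dU'; exact: Umax.
    by rewrite -dU; exact: Umax'.
  have sgn := card_neg_sign k_le lam_le lam0 cN.
  have lam_neg (i j : 'I_(d - m)) : (i < j)%N -> (i < k)%N -> lam i < lam j.
    move=> ij ik; case: (ltnP j k) => [jk|kj]; first by rewrite lam_lt// ij.
    have := sgn i; have := sgn j; rewrite ik ltnNge kj /= => j0 i0.
    exact: lt_trans i0 j0.
  have vo : orthonormal_family dot v.
    move=> i j; case: (ltngtP i j) => [ij|ji|/ord_inj ->]; last by rewrite v1 eqxx.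
      rewrite ord_ltn_eqF//; apply: (eigenvectors_orthogonal _ (Sv i) (Sv j)).
        exact: S_sym.
      by rewrite lt_eqF// lam_neg/=.
    rewrite eq_sym ord_ltn_eqF//; apply: (eigenvectors_orthogonal _ (Sv i) (Sv j)).
      exact: S_sym.
    by rewrite gt_eqF// lam_neg/=.
  have Jx := jacobian_x dotE c3 E_C3 mu v G_unit x_on g0.
  have Jv := jacobian_v dotE c3 E_C3 mu G_unit x_on g0 v_tangent vo Sv.
  have [f [fo fT Sf fv]] := extend_eigenbasis S_sym v_tangent eo eT Se vo Sv sgn.
  split.
    rewrite /steady_state /saddle_dynamics /=.
    rewrite (rhs_x_critical mu x_on g0); congr pair; apply/ffunP => i.
    rewrite !ffunE (rhs_v_critical mu x_on g0) (QS _ (v_tangent i)).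
    by rewrite (eigenvectors_steady vo Sv) oppr0.
  exact: (saddle_stable (@tangentP _ _ dot _ c x) (rhess_mem G_unit E) S_sym
    (rhess_ext_mem G_unit E) Q_adj v_tangent vo Sv mu_gt0 Jx Jv fo fT dimT Sf fv
    lam_neg sgn).
Qed.
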